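(* Let $\Bbbk$ be a field of characteristic $\neq2$, let $G=\langle g,h\rangle\cong(\mathbb{Z}^2,+)$ (written multiplicatively), let $\chi:G\times G\to\Bbbk^\times$ be an antisymmetric bicharacter with $\chi(g,g)=\chi(h,h)=1$, and let $\mathcal{C}$ be the category of $(G,\chi)$-color vector spaces over $\Bbbk$, viewed as a Cartier category with zero infinitesimal braiding. Let $\mathfrak{f}=\Bbbk s+\Bbbk t$ be a two-dimensional object of $\mathcal{C}$ of $G$-degree $1$, regarded as a Lie bialgebra in $\mathcal{C}$ with zero bracket and zero cobracket. Let $\mathcal{G}\in\mathbb{N}_0$ and let $L(1,\mathcal{G})\in\mathcal{C}$ be the $(\mathcal{G}+3)$-dimensional $G$-graded vector space with basis $x_1,x_2,z_0,\dots,z_{\mathcal{G}}$, where $x_1,x_2$ have degree $g$ and $z_k$ has degree $g^kh$ for $0\le k\le\mathcal{G}$. Let $L_0(1,\mathcal{G})$ be the subspace spanned by $x_1$ and $z_k$, $0\le k\le\mathcal{G}$. Then $L(1,\mathcal{G})\in{}^{\mathfrak{f}}_{\mathfrak{f}}\mathcal{C}$ (that is, it is a left crossed module over $\mathfrak{f}$ in $\mathcal{C}$) with the following coaction $\lambda$ and action $\alpha$ of $\mathfrak{f}$: $$\lambda(x_1)=s\otimes x_1,\quad \lambda(x_2)=s\otimes x_2,\quad \lambda(z_k)=(ks+t)\otimes z_k$$ for all $0\le k\le\mathcal{G}$, and $$s\cdot x_2=x_1,\quad t\cdot x_2=-\frac{\mathcal{G}}{2}x_1,\quad s\cdot x=t\cdot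 x=0\quad\text{for all }x\in L_0(1,\mathcal{G}),$$ where $f\cdot x=\alpha(f\otimes x)$ for all $f\in\mathfrak{f}$ and $x\in L(1,\mathcal{G})$. Moreover, $L(1,\mathcal{G})$ is a (curved) Lie bialgebra in $({}^{\mathfrak{f}}_{\mathfrak{f}}\mathcal{C},\widehat{\eta})$ with the natural (non-zero) infinitesimal braiding $\widehat{\eta}$ of ${}^{\mathfrak{f}}_{\mathfrak{f}}\mathcal{C}$, bracket $\beta$ and cobracket $\delta$, where $$\beta(x\otimes y)=0\quad\text{for all }x,y\in L_0(1,\mathcal{G}),$$ $$\beta(x_2\otimes x_1)=\beta(x_2\otimes x_2)=\beta(x_1\otimes x_2)=0,$$ $$\beta(x_2\otimes z_k)=-\beta\tau(x_2\otimes z_k)=z_{k+1},$$ $$\delta(x_1)=\delta(x_2)=0,\qquad \delta(z_k)=\frac{k(k-1-\mathcal{G})}{2}(\tau-\mathrm{id})(x_1\otimes z_{k-1})$$ for all $0\le k\le\mathcal{G}$ (with the convention $z_{\mathcal{G}+1}=0$ and $z_{-1}=0$).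
   Context: **Color vector spaces.** For an abelian group $G$ (written multiplicatively, neutral element $1$) and a field $\Bbbk$, an antisymmetric bicharacter is a map $\chi:G\times G\to\Bbbk^\times$ with $\chi(g_1,g_2)\chi(g_2,g_1)=1$ and $\chi(g_1g_2,h)=\chi(g_1,h)\chi(g_2,h)$. The category of $(G,\chi)$-color vector spaces is the category of $G$-graded $\Bbbk$-vector spaces and degree-preserving linear maps, with the usual graded tensor product and the symmetry $\tau_{V,W}(v\otimes w)=\chi(a,b)\,w\otimes v$ for $v\in V_a$, $w\in W_b$. (Monoidal categories are treated as strict.) **Cartier categories.** A Cartier category $(\mathcal{C},\eta)$ is a symmetric monoidal category $\mathcal{C}$ (symmetry $\tau$) with hom-sets abelian groups and biadditive composition and tensor product of morphisms, together with a natural transformation $\eta=(\eta_{X,Y}:X\otimes Y\to X\otimes Y)$ of $\otimes$ to itself (the infinitesimal braiding) with $$\eta_{X,Y\otimes Z}=\eta_{X,Y}\otimes\mathrm{id}_Z+(\tau_{Y,X}\otimes\mathrm{id}_Z)(\mathrm{id}_Y\otimes\eta_{X,Z})(\tau_{X,Y}\otimes\mathrm{id}_Z),\qquad \eta_{Y,X}\tau_{X,Y}=\tau_{X,Y}\eta_{X,Y}.$$ Below $\tau_{12}$ denotes $\tau$ applied to the first two tensor factors. **Lie structures.** A Lie algebra in $\mathcal{C}$ is $(\mathfrak{g},\beta)$, $\beta:\mathfrak{g}\otimes\mathfrak{g}\to\mathfrak{g}$, with $\beta(\mathrm{id}+\tau)=0$ and $\beta(\beta\otimes\mathrm{id})=\beta(\mathrm{id}\otimes\beta)(\mathrm{id}-\tau_{12})$.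 A Lie coalgebra is $(\mathfrak{g},\delta)$, $\delta:\mathfrak{g}\to\mathfrak{g}\otimes\mathfrak{g}$, with $(\mathrm{id}+\tau)\delta=0$ and $(\delta\otimes\mathrm{id})\delta=(\mathrm{id}-\tau_{12})(\mathrm{id}\otimes\delta)\delta$. A Lie bialgebra in $(\mathcal{C},\eta)$ (also called curved Lie bialgebra) is $(\mathfrak{g},\beta,\delta)$ with $(\mathfrak{g},\beta)$ a Lie algebra, $(\mathfrak{g},\delta)$ a Lie coalgebra in $\mathcal{C}$ and $$\delta\beta=(\mathrm{id}-\tau)(\beta\otimes\mathrm{id})(\mathrm{id}\otimes\tau)(\delta\otimes\mathrm{id})(\mathrm{id}-\tau)+(\tau-\mathrm{id})\eta_{\mathfrak{g},\mathfrak{g}}.$$ **Crossed modules.** A left crossed module over a Lie bialgebra $(\mathfrak{f},\beta_{\mathfrak{f}},\delta_{\mathfrak{f}})$ in $(\mathcal{C},\eta)$ is $(V,\alpha,\lambda)$ with morphisms $\alpha:\mathfrak{f}\otimes V\to V$, $\lambda:V\to\mathfrak{f}\otimes V$ in $\mathcal{C}$ satisfying $\alpha(\beta_{\mathfrak{f}}\otimes\mathrm{id})=\alpha(\mathrm{id}\otimes\alpha)(\mathrm{id}-\tau_{12})$ (Lie module), $(\delta_{\mathfrak{f}}\otimes\mathrm{id})\lambda=(\mathrm{id}-\tau_{12})(\mathrm{id}\otimes\lambda)\lambda$ (Lie comodule) and $$\lambda\alpha=(\beta_{\mathfrak{f}}\otimes\mathrm{id})(\mathrm{id}\otimes\lambda)+(\mathrm{id}\otimes\alpha)(\tau_{\mathfrak{f},\mathfrak{f}}\otimes\mathrm{id})(\mathrm{id}\otimes\lambda)+(\mathrm{id}\otimes\alpha)(\delta_{\mathfrak{f}}\otimes\mathrm{id})-\eta_{\mathfrak{f},V}.$$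 Morphisms in ${}^{\mathfrak{f}}_{\mathfrak{f}}\mathcal{C}$ are morphisms in $\mathcal{C}$ commuting with actions and coactions; on tensor products $\alpha_{V\otimes W}=\alpha_V\otimes\mathrm{id}_W+(\mathrm{id}_V\otimes\alpha_W)(\tau_{\mathfrak{f},V}\otimes\mathrm{id}_W)$ and $\lambda_{V\otimes W}=\lambda_V\otimes\mathrm{id}_W+(\tau_{V,\mathfrak{f}}\otimes\mathrm{id}_W)(\mathrm{id}_V\otimes\lambda_W)$; the symmetry is $\tau$. The natural infinitesimal braiding of ${}^{\mathfrak{f}}_{\mathfrak{f}}\mathcal{C}$ is $$\widehat{\eta}_{V,W}=\zeta_{W,V}\tau_{V,W}+\tau_{W,V}\zeta_{V,W}+\eta_{V,W},\qquad \zeta_{V,W}=(\alpha_W\otimes\mathrm{id}_V)(\mathrm{id}_{\mathfrak{f}}\otimes\tau_{V,W})(\lambda_V\otimes\mathrm{id}_W),$$ and $({}^{\mathfrak{f}}_{\mathfrak{f}}\mathcal{C},\widehat{\eta})$ is a Cartier category. Here $\eta=0$ on $\mathcal{C}$. Lie bialgebras in $({}^{\mathfrak{f}}_{\mathfrak{f}}\mathcal{C},\widehat{\eta})$ have bracket and cobracket that are morphisms in ${}^{\mathfrak{f}}_{\mathfrak{f}}\mathcal{C}$, and the compatibility condition uses $\widehat{\eta}$ in place of $\eta$. *)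

(* Defs.v *)
From HB Require Import structures.
From mathcomp Require Import all_boot all_order all_algebra.
From mathcomp Require Import boolp.

Set Implicit Arguments.
Unset Strict Implicit.
Unset Printing Implicit Defensive.

Import GRing.Theory.
Local Open Scope ring_scope.
Local Open Scope quotient_scope.

(** * Cartier categories *)

(** Symmetric monoidal categories are not assumed strict: [asc], [cas] (its
    inverse) and the unitors appear explicitly. *)
Record smCat := SMCat {
  obj :> Type;
  hom : obj -> obj -> zmodType;
  idm : forall X, hom X X;
  cmp : forall X Y Z, hom Y Z -> hom X Y -> hom X Z;
  ten : obj -> obj -> obj;
  tenm : forall X X' Y Y', hom X X' -> hom Y Y' -> hom (ten X Y) (ten X' Y');
  tunit : obj;
  asc : forall X Y Z, hom (ten (ten X Y) Z) (ten X (ten Y Z));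
  cas : forall X Y Z, hom (ten X (ten Y Z)) (ten (ten X Y) Z);
  lun : forall X, hom (ten tunit X) X;
  lunV : forall X, hom X (ten tunit X);
  run : forall X, hom (ten X tunit) X;
  runV : forall X, hom X (ten X tunit);
  sym : forall X Y, hom (ten X Y) (ten Y X);
  cmpA : forall X Y Z T (h : hom Z T) (g : hom Y Z) (f : hom X Y),
    cmp h (cmp g f) = cmp (cmp h g) f;
  cmp1m : forall X Y (f : hom X Y), cmp (idm Y) f = f;
  cmpm1 : forall X Y (f : hom X Y), cmp f (idm X) = f;
  cmpDl : forall X Y Z (g g' : hom Y Z) (f : hom X Y),
    cmp (g + g') f = cmp g f + cmp g' f;
  cmpDr : forall X Y Z (g : hom Y Z) (f f' : hom X Y),
    cmp g (f + f') = cmp g f + cmp g f';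
  tenm1 : forall X Y, tenm (idm X) (idm Y) = idm (ten X Y);
  tenm_cmp : forall X X' X'' Y Y' Y''
    (f' : hom X' X'') (f : hom X X') (g' : hom Y' Y'') (g : hom Y Y'),
    tenm (cmp f' f) (cmp g' g) = cmp (tenm f' g') (tenm f g);
  tenmDl : forall X X' Y Y' (f f' : hom X X') (g : hom Y Y'),
    tenm (f + f') g = tenm f g + tenm f' g;
  tenmDr : forall X X' Y Y' (f : hom X X') (g g' : hom Y Y'),
    tenm f (g + g') = tenm f g + tenm f g';
  ascK : forall X Y Z, cmp (cas X Y Z) (asc X Y Z) = idm _;
  casK : forall X Y Z, cmp (asc X Y Z) (cas X Y Z) = idm _;
  asc_nat : forall X X' Y Y' Z Z' (f : hom X X') (g : hom Y Y') (h : hom Z Z'),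
    cmp (asc X' Y' Z') (tenm (tenm f g) h) =
    cmp (tenm f (tenm g h)) (asc X Y Z);
  lunK : forall X, cmp (lunV X) (lun X) = idm _;
  lunVK : forall X, cmp (lun X) (lunV X) = idm _;
  lun_nat : forall X Y (f : hom X Y),
    cmp (lun Y) (tenm (idm _) f) = cmp f (lun X);
  runK : forall X, cmp (runV X) (run X) = idm _;
  runVK : forall X, cmp (run X) (runV X) = idm _;
  run_nat : forall X Y (f : hom X Y),
    cmp (run Y) (tenm f (idm _)) = cmp f (run X);
  pentagon : forall X Y Z T,
    cmp (asc X Y (ten Z T)) (asc (ten X Y) Z T) =
    cmp (tenm (idm X) (asc Y Z T))
        (cmp (asc X (ten Y Z) T) (tenm (asc X Y Z) (idm T)));
  triangle : forall X Y,
    cmp (tenm (idm X) (lun Y)) (asc X tunit Y) = tenm (run X) (idm Y);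
  symK : forall X Y, cmp (sym Y X) (sym X Y) = idm _;
  sym_nat : forall X X' Y Y' (f : hom X X') (g : hom Y Y'),
    cmp (sym X' Y') (tenm f g) = cmp (tenm g f) (sym X Y);
  hexagon : forall X Y Z,
    cmp (asc Y Z X) (cmp (sym X (ten Y Z)) (asc X Y Z)) =
    cmp (tenm (idm Y) (sym X Z))
        (cmp (asc Y X Z) (tenm (sym X Y) (idm Z)))
}.

Declare Scope cat_scope.
Delimit Scope cat_scope with cat.
Notation "X ⊗ Y" := (ten X Y)
  (at level 40, left associativity) : cat_scope.
Notation "f ⊠ g" := (tenm f g)
  (at level 40, left associativity) : cat_scope.
Notation "g ∘ f" := (cmp g f)
  (at level 45, right associativity) : cat_scope.
Notation "'id_' X" := (idm X)
  (at level 8, X at level 2, format "'id_' X") : cat_scope.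
Local Open Scope cat_scope.

Record infBraiding (C : smCat) := InfBraiding {
  ibr :> forall X Y : C, hom (X ⊗ Y) (X ⊗ Y);
  ibr_nat : forall (X X' Y Y' : C) (f : hom X X') (g : hom Y Y'),
    ibr X' Y' ∘ (f ⊠ g) = (f ⊠ g) ∘ ibr X Y;
  ibr_ten : forall X Y Z : C,
    ibr X (Y ⊗ Z) =
      asc X Y Z ∘ (ibr X Y ⊠ id_ Z) ∘ cas X Y Z
      + asc X Y Z ∘ (sym Y X ⊠ id_ Z) ∘ cas Y X Z ∘ (id_ Y ⊠ ibr X Z)
        ∘ asc Y X Z ∘ (sym X Y ⊠ id_ Z) ∘ cas X Y Z;
  ibr_sym : forall X Y : C, ibr Y X ∘ sym X Y = sym X Y ∘ ibr X Y
}.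

Record cartierCat := CartierCat {
  ccat :> smCat;
  cbr : infBraiding ccat
}.

Section SmCatTheory.
Variable C : smCat.

Lemma cmp0m (X Y Z : C) (f : hom X Y) : (0 : hom Y Z) ∘ f = 0.
Proof. by apply: (addrI (0 ∘ f)); rewrite -cmpDl !addr0. Qed.

Lemma cmpm0 (X Y Z : C) (g : hom Y Z) : g ∘ (0 : hom X Y) = 0.
Proof. by apply: (addrI (g ∘ 0)); rewrite -cmpDr !addr0. Qed.

Lemma ten0m (X X' Y Y' : C) (g : hom Y Y') : (0 : hom X X') ⊠ g = 0.
Proof. by apply: (addrI (0 ⊠ g)); rewrite -tenmDl !addr0. Qed.

Lemma tenm0 (X X' Y Y' : C) (f : hom X X') : f ⊠ (0 : hom Y Y') = 0.
Proof. by apply: (addrI (f ⊠ 0)); rewrite -tenmDr !addr0. Qed.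

Definition zero_braiding : infBraiding C.
Proof.
exists (fun X Y => 0) => [*|*|*]; rewrite ?cmp0m ?cmpm0 //.
by rewrite ten0m tenm0 !(cmp0m, cmpm0) addr0.
Defined.

End SmCatTheory.

Definition zeroCartier (C : smCat) : cartierCat := CartierCat (zero_braiding C).

(** * Lie algebras, Lie coalgebras, Lie bialgebras *)

Section Lie.
Variables (C : smCat) (g : C).

Definition lie_algebra (br : hom (g ⊗ g) g) : Prop :=
  br ∘ (id_ (g ⊗ g) + sym g g) = 0 /\
  br ∘ (br ⊠ id_ g) =
    br ∘ (id_ g ⊠ br) ∘ asc g g g ∘ (id_ (g ⊗ g ⊗ g) - sym g g ⊠ id_ g).

Definition lie_coalgebra (cobr : hom g (g ⊗ g)) : Prop :=
  (id_ (g ⊗ g) + sym g g) ∘ cobr = 0 /\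
  (cobr ⊠ id_ g) ∘ cobr =
    (id_ (g ⊗ g ⊗ g) - sym g g ⊠ id_ g) ∘ cas g g g ∘ (id_ g ⊠ cobr) ∘ cobr.

(** [e] is the component at [(g, g)] of the infinitesimal braiding. *)
Definition lie_compat (e : hom (g ⊗ g) (g ⊗ g))
    (br : hom (g ⊗ g) g) (cobr : hom g (g ⊗ g)) : Prop :=
  cobr ∘ br =
    (id_ (g ⊗ g) - sym g g) ∘ (br ⊠ id_ g) ∘ cas g g g ∘ (id_ g ⊠ sym g g)
      ∘ asc g g g ∘ (cobr ⊠ id_ g) ∘ (id_ (g ⊗ g) - sym g g)
    + (sym g g - id_ (g ⊗ g)) ∘ e.

End Lie.

Definition lie_bialgebra (C : cartierCat) (g : C)
    (br : hom (g ⊗ g) g) (cobr : hom g (g ⊗ g)) : Prop :=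
  [/\ lie_algebra br, lie_coalgebra cobr & lie_compat (cbr C g g) br cobr].

Record lieBialgebra (C : cartierCat) := LieBialgebra {
  lb_obj :> C;
  lb_br : hom (lb_obj ⊗ lb_obj) lb_obj;
  lb_cobr : hom lb_obj (lb_obj ⊗ lb_obj);
  lb_axioms : lie_bialgebra lb_br lb_cobr
}.

Lemma trivial_lie_bialgebra (C : smCat) (g : zeroCartier C) :
  @lie_bialgebra (zeroCartier C) g 0 0.
Proof.
split; [split|split|]; rewrite /lie_compat /= ?ten0m ?tenm0;
by rewrite !(cmp0m, cmpm0) ?addr0.
Qed.

Definition trivialLie (C : smCat) (g : C) : lieBialgebra (zeroCartier C) :=
  LieBialgebra (trivial_lie_bialgebra g).

(** * Crossed modules over a Lie bialgebra *)

Section Crossed.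
Variables (C : cartierCat) (f : lieBialgebra C).
Implicit Types V W : C.

Definition crossed_module V
    (act : hom (f ⊗ V) V) (coact : hom V (f ⊗ V)) : Prop :=
  [/\ act ∘ (lb_br f ⊠ id_ V) =
        act ∘ (id_ f ⊠ act) ∘ asc f f V
          ∘ (id_ (f ⊗ f ⊗ V) - sym f f ⊠ id_ V),
      (lb_cobr f ⊠ id_ V) ∘ coact =
        (id_ (f ⊗ f ⊗ V) - sym f f ⊠ id_ V) ∘ cas f f V
          ∘ (id_ f ⊠ coact) ∘ coact
    & coact ∘ act =
        (lb_br f ⊠ id_ V) ∘ cas f f V ∘ (id_ f ⊠ coact)
        + (id_ f ⊠ act) ∘ asc f f V ∘ (sym f f ⊠ id_ V) ∘ cas f f V
            ∘ (id_ f ⊠ coact)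
        + (id_ f ⊠ act) ∘ asc f f V ∘ (lb_cobr f ⊠ id_ V)
        - cbr C f V].

Definition ten_act V W (actV : hom (f ⊗ V) V) (actW : hom (f ⊗ W) W) :
    hom (f ⊗ (V ⊗ W)) (V ⊗ W) :=
  (actV ⊠ id_ W) ∘ cas f V W
  + (id_ V ⊠ actW) ∘ asc V f W ∘ (sym f V ⊠ id_ W) ∘ cas f V W.

Definition ten_coact V W (coactV : hom V (f ⊗ V)) (coactW : hom W (f ⊗ W)) :
    hom (V ⊗ W) (f ⊗ (V ⊗ W)) :=
  asc f V W ∘ (coactV ⊠ id_ W)
  + asc f V W ∘ (sym V f ⊠ id_ W) ∘ cas V f W ∘ (id_ V ⊠ coactW).

Definition crossed_morphism V W
    (actV : hom (f ⊗ V) V) (coactV : hom V (f ⊗ V))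
    (actW : hom (f ⊗ W) W) (coactW : hom W (f ⊗ W)) (p : hom V W) : Prop :=
  p ∘ actV = actW ∘ (id_ f ⊠ p) /\ coactW ∘ p = (id_ f ⊠ p) ∘ coactV.

Definition zeta V W (coactV : hom V (f ⊗ V)) (actW : hom (f ⊗ W) W) :
    hom (V ⊗ W) (W ⊗ V) :=
  (actW ⊠ id_ V) ∘ cas f W V ∘ (id_ f ⊠ sym V W) ∘ asc f V W
    ∘ (coactV ⊠ id_ W).

Definition eta_hat V W
    (actV : hom (f ⊗ V) V) (coactV : hom V (f ⊗ V))
    (actW : hom (f ⊗ W) W) (coactW : hom W (f ⊗ W)) :
    hom (V ⊗ W) (V ⊗ W) :=
  zeta coactW actV ∘ sym V W + sym W V ∘ zeta coactV actW + cbr C V W.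

(** Lie bialgebras in the Cartier category of crossed modules over [f], whose
    infinitesimal braiding is [eta_hat]; its symmetry, composition and tensor
    product of morphisms are those of [C]. *)
Definition crossed_lie_bialgebra V
    (act : hom (f ⊗ V) V) (coact : hom V (f ⊗ V))
    (br : hom (V ⊗ V) V) (cobr : hom V (V ⊗ V)) : Prop :=
  [/\ crossed_module act coact,
      crossed_morphism (ten_act act act) (ten_coact coact coact) act coact br
    & crossed_morphism act coact (ten_act act act) (ten_coact coact coact) cobr]
  /\
  [/\ lie_algebra br,
      lie_coalgebra cobr
    & lie_compat (eta_hat act coact act coact) br cobr].

End Crossed.

Local Close Scope cat_scope.

(** * Tensor product of vector spaces *)

Notation bilin b := (bilinear_for *:%R *:%R b).

Section Tensor.
Variables (k : fieldType) (V W : lmodType k).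

(** A list of pairs [(v_i, w_i)] stands for [\sum_i v_i ⊗ w_i]; two lists are
    identified when no bilinear map separates them. *)
Definition tens_rel (s t : seq (V * W)) : bool :=
  `[< forall (U : lmodType k) (b : V -> W -> U), bilin b ->
        \sum_(p <- s) b p.1 p.2 = \sum_(p <- t) b p.1 p.2 >].

Lemma tens_rel_refl : reflexive tens_rel.
Proof. by move=> s; apply/asboolP. Qed.

Lemma tens_rel_sym : symmetric tens_rel.
Proof. by move=> s t; apply/asboolP/asboolP => H U b bb; rewrite (H U b bb). Qed.

Lemma tens_rel_trans : transitive tens_rel.
Proof.
move=> s t u /asboolP H1 /asboolP H2; apply/asboolP => U b bb.
by rewrite (H1 U b bb) (H2 U b bb).
Qed.

Definition tens_equiv : equiv_rel (seq (V * W)) :=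
  EquivRel tens_rel tens_rel_refl tens_rel_sym tens_rel_trans.

Definition tens := {eq_quot tens_equiv}.
HB.instance Definition _ := Choice.on tens.

Implicit Types (x y z : tens) (U : lmodType k).

Definition tpure (v : V) (w : W) : tens := \pi_tens [:: (v, w)].

(** The linear map induced by [b], meaningful when [b] is bilinear. *)
Definition tlift U (b : V -> W -> U) (x : tens) : U :=
  \sum_(p <- repr x) b p.1 p.2.

Lemma tlift_pi U (b : V -> W -> U) s : bilin b ->
  tlift b (\pi_tens s) = \sum_(p <- s) b p.1 p.2.
Proof.
move=> bb; rewrite /tlift.
have /eqmodP /asboolP H : repr (\pi_tens s) = s %[mod tens] by rewrite reprK.
exact: H.
Qed.

Lemma tlift_pure U (b : V -> W -> U) v w : bilin b ->
  tlift b (tpure v w) = b v w.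
Proof. by move=> bb; rewrite tlift_pi // big_seq1. Qed.

Lemma tens_eqP x y :
  (forall U (b : V -> W -> U), bilin b -> tlift b x = tlift b y) -> x = y.
Proof.
move=> H; rewrite -[x]reprK -[y]reprK; apply/eqmodP/asboolP => U b bb.
exact: H.
Qed.

Definition tadd x y : tens := \pi_tens (repr x ++ repr y).
Definition tzero : tens := \pi_tens [::].
Definition tscale (c : k) x : tens :=
  \pi_tens [seq (c *: p.1, p.2) | p <- repr x].
Definition topp x : tens := tscale (-1) x.

Lemma tliftD U (b : V -> W -> U) x y : bilin b ->
  tlift b (tadd x y) = tlift b x + tlift b y.
Proof. by move=> bb; rewrite tlift_pi // big_cat. Qed.

Lemma tlift0 U (b : V -> W -> U) : bilin b -> tlift b tzero = 0.
Proof. by move=> bb; rewrite tlift_pi // big_nil. Qed.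

Lemma bilinZl U (b : V -> W -> U) c v w : bilin b -> b (c *: v) w = c *: b v w.
Proof.
move=> [bl _]; have b0 : b 0 w = 0.
  by have /= := bl w (-1) 0 0; rewrite scaler0 addr0 scaleN1r addNr.
by have /= := bl w c v 0; rewrite !addr0 b0 addr0.
Qed.

Lemma tliftZ U (b : V -> W -> U) c x : bilin b ->
  tlift b (tscale c x) = c *: tlift b x.
Proof.
move=> bb; rewrite tlift_pi // big_map scaler_sumr.
by apply: eq_bigr => p _; rewrite /= bilinZl.
Qed.

Lemma tliftN U (b : V -> W -> U) x : bilin b -> tlift b (topp x) = - tlift b x.
Proof. by move=> bb; rewrite tliftZ // scaleN1r. Qed.

Lemma taddA : associative tadd.
Proof. by move=> x y z; apply: tens_eqP => U b bb; rewrite !tliftD ?addrA. Qed.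

Lemma taddC : commutative tadd.
Proof. by move=> x y; apply: tens_eqP => U b bb; rewrite !tliftD // addrC. Qed.

Lemma tadd0 : left_id tzero tadd.
Proof. by move=> x; apply: tens_eqP => U b bb; rewrite tliftD // tlift0 ?add0r. Qed.

Lemma taddN : left_inverse tzero topp tadd.
Proof.
by move=> x; apply: tens_eqP => U b bb; rewrite tliftD // tliftN // tlift0 // addNr.
Qed.

HB.instance Definition _ :=
  GRing.isZmodule.Build tens taddA taddC tadd0 taddN.

Lemma tscaleA c d x : tscale c (tscale d x) = tscale (c * d) x.
Proof. by apply: tens_eqP => U b bb; rewrite !tliftZ // scalerA. Qed.

Lemma tscale1 : left_id 1 tscale.
Proof. by move=> x; apply: tens_eqP => U b bb; rewrite tliftZ // scale1r. Qed.

Lemma tscaleDr : right_distributive tscale +%R.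
Proof.
move=> c x y; apply: tens_eqP => U b bb.
by rewrite [RHS]tliftD // !tliftZ // [tlift b (x + y)]tliftD // scalerDr.
Qed.

Lemma tscaleDl x : {morph tscale^~ x : c d / c + d}.
Proof.
move=> c d; apply: tens_eqP => U b bb.
by rewrite [RHS]tliftD // !tliftZ // scalerDl.
Qed.

HB.instance Definition _ :=
  GRing.Zmodule_isLmodule.Build k tens tscaleA tscale1 tscaleDr tscaleDl.

Lemma tlift_linear U (b : V -> W -> U) : bilin b -> linear (tlift b).
Proof.
by move=> bb c x y; rewrite [LHS]tliftD // [tlift b (c *: x)]tliftZ.
Qed.

Lemma tpure_bilin : bilin tpure.
Proof.
split=> [w c v v'|v c w w']; apply: tens_eqP => U b bb;
  rewrite [RHS]tliftD // [tlift b (_ *: _)]tliftZ // !tlift_pure //.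
- exact: (bb.1 w).
- exact: (bb.2 v).
Qed.

Lemma tpureDl v v' w : tpure (v + v') w = tpure v w + tpure v' w.
Proof. by have /= := tpure_bilin.1 w 1 v v'; rewrite !scale1r. Qed.

Lemma tpureDr v w w' : tpure v (w + w') = tpure v w + tpure v w'.
Proof. by have /= := tpure_bilin.2 v 1 w w'; rewrite !scale1r. Qed.

Lemma tpure0l w : tpure 0 w = 0.
Proof. by apply: (addrI (tpure 0 w)); rewrite -tpureDl !addr0. Qed.

Lemma tpure0r v : tpure v 0 = 0.
Proof. by apply: (addrI (tpure v 0)); rewrite -tpureDr !addr0. Qed.

Lemma tpureZl c v w : tpure (c *: v) w = c *: tpure v w.
Proof. by have /= := tpure_bilin.1 w c v 0; rewrite tpure0l !addr0. Qed.

Lemma tpureZr c v w : tpure v (c *: w) = c *: tpure v w.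
Proof. by have /= := tpure_bilin.2 v c w 0; rewrite tpure0r !addr0. Qed.

Lemma tens_sum x : x = \sum_(p <- repr x) tpure p.1 p.2.
Proof.
apply: tens_eqP => U b bb.
pose l := HB.pack_for {linear tens -> U} (tlift b)
  (GRing.isLinear.Build _ _ _ _ _ (tlift_linear bb)).
rewrite -[RHS]/(l _) raddf_sum /=.
by apply: eq_bigr => p _; rewrite tlift_pure.
Qed.

Lemma tens_ext U (f f' : tens -> U) : linear f -> linear f' ->
  (forall v w, f (tpure v w) = f' (tpure v w)) -> f =1 f'.
Proof.
move=> lf lf' H x.
pose F := HB.pack_for {linear tens -> U} f (GRing.isLinear.Build _ _ _ _ _ lf).
pose F' := HB.pack_for {linear tens -> U} f' (GRing.isLinear.Build _ _ _ _ _ lf').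
rewrite (tens_sum x) -[LHS]/(F _) -[RHS]/(F' _) !raddf_sum.
by apply: eq_bigr => p _; exact: H.
Qed.

End Tensor.

(** * Color vector spaces *)

Section Graded.
Variables (k : fieldType) (G : zmodType).

(** A [G]-graded vector space, [G] written additively: [prj a] is the
    projection onto the component of degree [a], that is, onto
    [{v | prj a v = v}]; every vector is the sum of finitely many of its
    homogeneous components. *)
Record gspace := GSpace {
  gsort :> lmodType k;
  prj : G -> gsort -> gsort;
  prj_linear : forall a, linear (prj a);
  prj_prj : forall a b v, prj a (prj b v) = if a == b then prj b v else 0;
  prj_fin : forall v, exists s : seq G, v = \sum_(a <- undup s) prj a v
}.

Definition homog (V : gspace) (a : G) (v : V) : Prop := prj a v = v.

HB.instance Definition _ (V : gspace) (a : G) :=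
  GRing.isLinear.Build k V V _ (@prj V a) (@prj_linear V a).

Section GradedTheory.
Variable V : gspace.
Implicit Types (v : V) (a b : G) (U : lmodType k).

Definition gsupp v : seq G := undup (sval (cid (prj_fin v))).

Lemma gsuppE v : v = \sum_(a <- gsupp v) prj a v.
Proof. exact: svalP (cid (prj_fin v)). Qed.

Lemma gsupp_uniq v : uniq (gsupp v).
Proof. exact: undup_uniq. Qed.

Lemma gsuppPn v a : a \notin gsupp v -> prj a v = 0.
Proof.
move=> na; rewrite {1}(gsuppE v) raddf_sum big1_seq // => b /= bs.
by rewrite prj_prj; case: eqP => // eab; rewrite eab bs in na.
Qed.

Lemma homog_prj v a : homog a (prj a v).
Proof. by rewrite /homog prj_prj eqxx. Qed.

Lemma homog_prjE v a b : homog a v -> prj b v = if b == a then v else 0.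
Proof. by rewrite /homog => <-; rewrite prj_prj. Qed.

(** [\sum_a F a v_a], where [v_a] is the component of [v] of degree [a]. *)
Definition gsum U (F : G -> V -> U) v : U := \sum_(a <- gsupp v) F a (prj a v).

Lemma gsum_widen U (F : G -> V -> U) v s : (forall a, F a 0 = 0) ->
  uniq s -> {subset gsupp v <= s} -> gsum F v = \sum_(a <- s) F a (prj a v).
Proof.
move=> F0 us sub; rewrite [RHS](bigID (mem (gsupp v))) /=.
rewrite [X in _ = _ + X]big1 ?addr0; last by move=> a /gsuppPn ->.
rewrite /gsum -[RHS]big_filter; apply: perm_big; apply: uniq_perm.
- exact: gsupp_uniq.
- by rewrite filter_uniq.
move=> a; rewrite mem_filter /=; case: (boolP (a \in gsupp v)) => //= as_.
by rewrite sub.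
Qed.

Lemma linear0f (U U' : lmodType k) (f : U -> U') : linear f -> f 0 = 0.
Proof. by move=> lf; have := lf (-1) 0 0; rewrite scaler0 addr0 scaleN1r addNr. Qed.

Lemma gsum_linear U (F : G -> V -> U) :
  (forall a, linear (F a)) -> linear (gsum F).
Proof.
move=> lF c u v; pose s := undup (gsupp (c *: u + v) ++ gsupp u ++ gsupp v).
have us : uniq s by exact: undup_uniq.
have F0 a : F a 0 = 0 by exact: linear0f.
have E x : {subset gsupp x <= s} -> gsum F x = \sum_(a <- s) F a (prj a x).
  exact: gsum_widen.
have [s1 s2 s3] : [/\ {subset gsupp (c *: u + v) <= s}, {subset gsupp u <= s}
    & {subset gsupp v <= s}].
  by split=> a as_; rewrite mem_undup !mem_cat as_ ?orbT.
rewrite (E _ s1) (E _ s2) (E _ s3).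
rewrite /= scaler_sumr -big_split; apply: eq_bigr => a _.
by rewrite (prj_linear a) lF.
Qed.

Lemma gsum_homog U (F : G -> V -> U) a v : (forall b, F b 0 = 0) ->
  homog a v -> gsum F v = F a v.
Proof.
move=> F0 hv; rewrite (@gsum_widen _ F v (undup (a :: gsupp v))) ?undup_uniq //;
  last by move=> b; rewrite mem_undup inE => ->; rewrite orbT.
rewrite (bigD1_seq a) ?undup_uniq ?mem_undup ?mem_head //= hv big1 ?addr0 //.
by move=> b nb; rewrite (homog_prjE _ hv) (negPf nb).
Qed.

Definition spans (P : V -> Prop) := forall U (f f' : V -> U),
  linear f -> linear f' -> (forall v, P v -> f v = f' v) -> f =1 f'.

Lemma spans_homog : spans (fun v => exists a, homog a v).
Proof.
move=> U f f' lf lf' H v.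
pose F := HB.pack_for {linear V -> U} f (GRing.isLinear.Build _ _ _ _ _ lf).
pose F' := HB.pack_for {linear V -> U} f' (GRing.isLinear.Build _ _ _ _ _ lf').
rewrite (gsuppE v) -[LHS]/(F _) -[RHS]/(F' _) !raddf_sum.
by apply: eq_bigr => a _; apply: H; exists a; exact: homog_prj.
Qed.

End GradedTheory.

Section GTens.
Variables V W : gspace.

(** [(v ⊗ w)_c = \sum_a v_a ⊗ w_(c - a)] *)
Definition tprj (c : G) : tens V W -> tens V W :=
  tlift (fun v w => gsum (fun a (v' : V) => tpure v' (prj (c - a) w)) v).

Lemma tprj_bilin c :
  bilin (fun (v : V) (w : W) =>
    gsum (fun a (v' : V) => tpure v' (prj (c - a) w)) v).
Proof.
split=> [w|v]; first by apply: gsum_linear => a; exact: (tpure_bilin V W).1.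
move=> d w w'; rewrite /gsum /= scaler_sumr -big_split; apply: eq_bigr => a _.
by rewrite (prj_linear (c - a)) (tpure_bilin V W).2.
Qed.

Lemma tprj_linear c : linear (tprj c).
Proof. exact: tlift_linear (tprj_bilin c). Qed.

Lemma tprj_homog a b c (v : V) (w : W) : homog a v -> homog b w ->
  tprj c (tpure v w) = if c == a + b then tpure v w else 0.
Proof.
move=> hv hw; rewrite /tprj tlift_pure; last exact: tprj_bilin.
rewrite (gsum_homog _ hv); last by move=> d; rewrite tpure0l.
rewrite (homog_prjE _ hw) subr_eq [b + a]addrC.
by case: eqP => // _; rewrite ?tpure0r.
Qed.

Lemma tens_spans (P : V -> Prop) (Q : W -> Prop) : spans P -> spans Q ->
  forall (U : lmodType k) (f f' : tens V W -> U), linear f -> linear f' ->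
  (forall v w, P v -> Q w -> f (tpure v w) = f' (tpure v w)) -> f =1 f'.
Proof.
move=> sP sQ U f f' lf lf' H; apply: tens_ext => // v w.
have lr (h : tens V W -> U) (v' : V) : linear h -> linear (fun w => h (tpure v' w)).
  by move=> lh c u u'; rewrite (tpure_bilin V W).2 lh.
have ll (h : tens V W -> U) (w' : W) : linear h -> linear (fun v => h (tpure v w')).
  by move=> lh c u u'; rewrite [tpure _ _](tpure_bilin V W).1 lh.
apply: (sP U (fun v => f (tpure v w)) (fun v => f' (tpure v w))); rewrite ?ll //.
- exact: ll.
- exact: ll.
move=> v' Pv'.
apply: (sQ U (fun w => f (tpure v' w)) (fun w => f' (tpure v' w))).
- exact: lr.
- exact: lr.
by move=> w' Qw'; exact: H.
Qed.

Lemma tens_homog_ext (U : lmodType k) (f f' : tens V W -> U) :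
  linear f -> linear f' ->
  (forall a b v w, homog a v -> homog b w -> f (tpure v w) = f' (tpure v w)) ->
  f =1 f'.
Proof.
move=> lf lf' H; apply: tens_spans (@spans_homog V) (@spans_homog W) _ _ _ lf lf' _.
by move=> v w [a hv] [b hw]; exact: H hv hw.
Qed.

Lemma linear_id (U : lmodType k) : linear (fun u : U => u).
Proof. by []. Qed.

Lemma linear_comp (U U' U'' : lmodType k) (g : U' -> U'') (f : U -> U') :
  linear g -> linear f -> linear (fun u => g (f u)).
Proof. by move=> lg lf c u v; rewrite lf lg. Qed.

Lemma linear_zero (U U' : lmodType k) : linear (fun _ : U => 0 : U').
Proof. by move=> c u v; rewrite scaler0 addr0. Qed.

Lemma tprj_prj a b x : tprj a (tprj b x) = if a == b then tprj b x else 0.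
Proof.
move: x; apply: tens_homog_ext.
- exact: linear_comp (tprj_linear a) (tprj_linear b).
- by case: eqP => _; [exact: tprj_linear|exact: linear_zero].
move=> c d v w hv hw; rewrite (tprj_homog b hv hw).
case: eqP => [->|_]; last by rewrite (linear0f (@tprj_linear a)) if_same.
exact: tprj_homog.
Qed.

Lemma tprj_fin x : exists s : seq G, x = \sum_(a <- undup s) tprj a x.
Proof.
have T0 a : tprj a 0 = 0 by exact: (linear0f (@tprj_linear a)).
have TD a y z : tprj a (y + z) = tprj a y + tprj a z.
  by rewrite -[y]scale1r tprj_linear !scale1r.
have widen (y : tens V W) s s' : y = \sum_(a <- undup s) tprj a y ->
    {subset s <= s'} -> y = \sum_(a <- undup s') tprj a y.
  move=> Ey sub; have nz a : a \notin s -> tprj a y = 0.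
    move=> na; rewrite Ey (big_morph (tprj a) (TD a) (T0 a)) big1_seq // => b.
    rewrite mem_undup => /= bs; rewrite tprj_prj.
    by case: eqP => // eab; rewrite eab bs in na.
  rewrite {1}Ey [RHS](bigID (mem s)) /= [X in _ = _ + X]big1 ?addr0;
    last by move=> a /nz.
  rewrite -[RHS]big_filter; apply: perm_big; apply: uniq_perm;
    rewrite ?filter_uniq ?undup_uniq // => a.
  rewrite mem_filter !mem_undup /=; case: (boolP (a \in s)) => //= as_.
  by rewrite sub.
pose dec (y : tens V W) := exists s : seq G, y = \sum_(a <- undup s) tprj a y.
have decD y z : dec y -> dec z -> dec (y + z).
  move=> [s Ey] [t Ez]; exists (s ++ t).
  have sy : {subset s <= s ++ t} by move=> a as_; rewrite mem_cat as_.
  have sz : {subset t <= s ++ t} by move=> a as_; rewrite mem_cat as_ orbT.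
  rewrite {1}(widen y s _ Ey sy) {1}(widen z t _ Ez sz) -big_split.
  by apply: eq_bigr => a _; rewrite TD.
have dec0 : dec 0 by exists [::]; rewrite big_nil.
rewrite -/(dec x) (tens_sum x); elim/big_ind: _ => // p _.
have -> : tpure p.1 p.2 = \sum_(a <- gsupp p.1) \sum_(b <- gsupp p.2)
    tpure (prj a p.1) (prj b p.2).
  rewrite {1}(gsuppE p.1).
  rewrite (big_morph _ (fun u v => tpureDl u v p.2) (tpure0l _ p.2)).
  apply: eq_bigr => a _; rewrite {1}(gsuppE p.2).
  by rewrite (big_morph _ (tpureDr (prj a p.1)) (tpure0r _ _)).
elim/big_ind: _ => // a _; elim/big_ind: _ => // b _.
exists [:: a + b]; rewrite /= big_seq1.
by rewrite (tprj_homog _ (homog_prj _ _) (homog_prj _ _)) eqxx.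
Qed.

Definition gtens : gspace := GSpace tprj_linear tprj_prj tprj_fin.

Lemma homog_tpure a b (v : V) (w : W) : homog a v -> homog b w ->
  homog (a + b) (tpure v w : gtens).
Proof. by move=> hv hw; rewrite /homog /= (tprj_homog _ hv hw) eqxx. Qed.

End GTens.

Lemma gunit_prj_linear a : linear (fun v : k^o => if a == 0 :> G then v else 0 : k^o).
Proof. by move=> c u v; case: eqP => // _; rewrite scaler0 addr0. Qed.

Lemma gunit_prj_prj (a b : G) (v : k^o) :
  (if a == 0 then if b == 0 then v else 0 else 0 : k^o) =
  if a == b then if b == 0 then v else 0 else 0.
Proof.
case: (eqVneq a b) => [->|nab]; first by case: eqP.
by case: (eqVneq a 0) => // a0; rewrite -a0 eq_sym (negPf nab).
Qed.

Lemma gunit_prj_fin (v : k^o) :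
  exists s : seq G, v = \sum_(a <- undup s) if a == 0 then v else 0 : k^o.
Proof. by exists [:: 0]; rewrite big_seq1 eqxx. Qed.

Definition gunit : gspace :=
  GSpace gunit_prj_linear gunit_prj_prj gunit_prj_fin.

Record gmor (V W : gspace) := GMor {
  gfun :> V -> W;
  gfun_linear : linear gfun;
  gfun_prj : forall a v, gfun (prj a v) = prj a (gfun v)
}.

Lemma gmorP V W (f f' : gmor V W) : f =1 f' -> f = f'.
Proof.
case: f f' => [f lf pf] [f' lf' pf'] /= /funext E; rewrite E in lf pf *.
by congr GMor; exact: Prop_irrelevance.
Qed.

HB.instance Definition _ V W := gen_eqMixin (gmor V W).
HB.instance Definition _ V W := gen_choiceMixin (gmor V W).

HB.instance Definition _ V W (f : gmor V W) :=
  GRing.isLinear.Build k V W _ (gfun f) (gfun_linear f).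

Lemma gmor_homog V W (f : gmor V W) a (v : V) : homog a v -> homog a (f v).
Proof. by rewrite /homog => <-; rewrite -gfun_prj prj_prj eqxx. Qed.

(** It suffices to check degrees on homogeneous vectors. *)
Lemma homog_gfun_prj (V W : gspace) (P : V -> Prop) (f : V -> W) :
  spans P -> linear f ->
  (forall v, P v -> exists2 a, homog a v & homog a (f v)) ->
  forall a v, f (prj a v) = prj a (f v).
Proof.
move=> sP lf H a; apply: sP.
- exact: linear_comp lf (prj_linear a).
- exact: linear_comp (prj_linear a) lf.
move=> v /H [b hv hfv]; rewrite (homog_prjE _ hv) (homog_prjE _ hfv).
by case: eqP => // _; exact: linear0f.
Qed.

Section GMorZmod.
Variables V W : gspace.
Implicit Types f : gmor V W.

Lemma gzero_prj a (v : V) : 0 = prj a (0 : W).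
Proof. by rewrite raddf0. Qed.

Definition gzero : gmor V W := GMor (@linear_zero V W) gzero_prj.

Lemma gadd_linear f f' : linear (fun v => f v + f' v).
Proof. by move=> c u v; rewrite !linearP scalerDr addrACA. Qed.

Lemma gadd_prj f f' a v : f (prj a v) + f' (prj a v) = prj a (f v + f' v).
Proof. by rewrite !gfun_prj raddfD. Qed.

Definition gadd f f' : gmor V W := GMor (gadd_linear f f') (gadd_prj f f').

Lemma gopp_linear f : linear (fun v => - f v).
Proof. by move=> c u v; rewrite linearP opprD scalerN. Qed.

Lemma gopp_prj f a v : - f (prj a v) = prj a (- f v).
Proof. by rewrite !gfun_prj raddfN. Qed.

Definition gopp f : gmor V W := GMor (gopp_linear f) (gopp_prj f).

Lemma gaddA : associative gadd.
Proof. by move=> f g h; apply: gmorP => v /=; rewrite addrA. Qed.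
Lemma gaddC : commutative gadd.
Proof. by move=> f g; apply: gmorP => v /=; rewrite addrC. Qed.
Lemma gadd0 : left_id gzero gadd.
Proof. by move=> f; apply: gmorP => v /=; rewrite add0r. Qed.
Lemma gaddN : left_inverse gzero gopp gadd.
Proof. by move=> f; apply: gmorP => v /=; rewrite addNr. Qed.

HB.instance Definition _ :=
  GRing.isZmodule.Build (gmor V W) gaddA gaddC gadd0 gaddN.

End GMorZmod.

Definition gid (V : gspace) : gmor V V :=
  GMor (@linear_id V) (fun a v => erefl (prj a v)).

Lemma gcomp_prj (U V W : gspace) (g : gmor V W) (f : gmor U V) a u :
  g (f (prj a u)) = prj a (g (f u)).
Proof. by rewrite !gfun_prj. Qed.

Definition gcomp (U V W : gspace) (g : gmor V W) (f : gmor U V) : gmor U W :=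
  GMor (linear_comp (gfun_linear g) (gfun_linear f)) (gcomp_prj g f).

End Graded.

Lemma spans_all (k : fieldType) (G : zmodType) (V : gspace k G) :
  spans (fun _ : V => True).
Proof. by move=> U f f' _ _ H v; exact: H. Qed.

Lemma spans_tens (k : fieldType) (G : zmodType) (V W : gspace k G)
    (P : V -> Prop) (Q : W -> Prop) : spans P -> spans Q ->
  spans (fun x : gtens V W => exists v w, [/\ P v, Q w & x = tpure v w]).
Proof.
move=> sP sQ U f f' lf lf' H; apply: (tens_spans sP sQ) => // v w Pv Qw.
by apply: H; exists v, w.
Qed.

Lemma gmor_ext (k : fieldType) (G : zmodType) (V W : gspace k G)
    (P : V -> Prop) (f f' : gmor V W) : spans P ->
  (forall v, P v -> f v = f' v) -> f = f'.
Proof. by move=> sP H; apply: gmorP; apply: sP => // c u v; exact: linearP. Qed.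

Section GMorTens.
Variables (k : fieldType) (G : zmodType).
Local Notation gspace := (gspace k G).
Implicit Types U V W : gspace.

Lemma tlift_prj U V W (b : V -> W -> U) : bilin b ->
  (forall a c v w, homog a v -> homog c w -> homog (a + c) (b v w)) ->
  forall a (x : gtens V W), tlift b (prj a x) = prj a (tlift b x).
Proof.
move=> bb hb; apply: (homog_gfun_prj (spans_tens (@spans_homog _ _ V) (@spans_homog _ _ W))).
  exact: tlift_linear.
move=> _ [v [w [[a hv] [c hw] ->]]]; exists (a + c); first exact: homog_tpure.
by rewrite tlift_pure //; exact: hb.
Qed.

Definition gmor_tlift U V W (b : V -> W -> U) (bb : bilin b)
    (hb : forall a c v w, homog a v -> homog c w -> homog (a + c) (b v w)) :
    gmor (gtens V W) U :=
  @GMor k G (gtens V W) U (tlift b) (tlift_linear bb) (tlift_prj bb hb).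

Section Gten.
Variables (V V' W W' : gspace) (f : gmor V V') (g : gmor W W').

Lemma gten_bilin : bilin (fun v w => tpure (f v) (g w) : gtens V' W').
Proof.
split=> [w c v v'|v c w w']; rewrite linearP.
- by rewrite tpureDl tpureZl.
- by rewrite tpureDr tpureZr.
Qed.

Lemma gten_homog a c v w : homog a v -> homog c w ->
  homog (a + c) (tpure (f v) (g w) : gtens V' W').
Proof. by move=> hv hw; apply: homog_tpure; exact: gmor_homog. Qed.

(** [(f ⊗ g)(v ⊗ w) = f v ⊗ g w] *)
Definition gten : gmor (gtens V W) (gtens V' W') :=
  gmor_tlift gten_bilin gten_homog.

Lemma gtenE v w : gten (tpure v w) = tpure (f v) (g w).
Proof. exact: tlift_pure gten_bilin. Qed.

End Gten.

Section Assoc.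
Variables U V W : gspace.

Lemma gasc_bilin0 (w : W) :
  bilin (fun (u : U) (v : V) => tpure u (tpure v w : gtens V W)).
Proof.
split=> [v c u u'|u c v v'] /=.
- by rewrite tpureDl tpureZl.
- by rewrite tpureDl tpureZl tpureDr tpureZr.
Qed.

(** [(u ⊗ v) ⊗ w |-> u ⊗ (v ⊗ w)] *)
Definition gasc_fun : gtens (gtens U V) W -> gtens U (gtens V W) :=
  tlift (fun (x : gtens U V) (w : W) =>
    tlift (fun (u : U) (v : V) => tpure u (tpure v w : gtens V W)) x).

Lemma gasc_bilin : bilin (fun (x : gtens U V) (w : W) =>
  tlift (fun (u : U) (v : V) => tpure u (tpure v w : gtens V W)) x).
Proof.
split=> [w|x c w w']; first exact: tlift_linear (gasc_bilin0 w).
rewrite /tlift /= scaler_sumr -big_split; apply: eq_bigr => p _.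
by rewrite tpureDr tpureZr tpureDr tpureZr.
Qed.

Lemma gasc_linear : linear gasc_fun.
Proof. exact: tlift_linear gasc_bilin. Qed.

Lemma gasc_funE u v w :
  gasc_fun (tpure (tpure u v : gtens U V) w) = tpure u (tpure v w : gtens V W).
Proof.
by rewrite /gasc_fun (tlift_pure _ _ gasc_bilin) (tlift_pure _ _ (gasc_bilin0 w)).
Qed.

Lemma gasc_prj a x : gasc_fun (prj a x) = prj a (gasc_fun x).
Proof.
move: a x; apply: (homog_gfun_prj (spans_tens (spans_tens (@spans_homog _ _ U)
  (@spans_homog _ _ V)) (@spans_homog _ _ W))); first exact: gasc_linear.
move=> _ [_ [w [[u [v [[a hu] [b hv] ->]]] [c hw] ->]]].
exists (a + b + c); first by do 2 ?apply: homog_tpure.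
by rewrite gasc_funE -addrA; do 2 ?apply: homog_tpure.
Qed.

Definition gasc : gmor (gtens (gtens U V) W) (gtens U (gtens V W)) :=
  GMor gasc_linear gasc_prj.

Lemma gcas_bilin0 (u : U) :
  bilin (fun (v : V) (w : W) => tpure (tpure u v : gtens U V) w).
Proof.
split=> [w c v v'|v c w w'] /=.
- by rewrite tpureDr tpureZr tpureDl tpureZl.
- by rewrite tpureDr tpureZr.
Qed.

Definition gcas_fun : gtens U (gtens V W) -> gtens (gtens U V) W :=
  tlift (fun (u : U) (x : gtens V W) =>
    tlift (fun (v : V) (w : W) => tpure (tpure u v : gtens U V) w) x).

Lemma gcas_bilin : bilin (fun (u : U) (x : gtens V W) =>
    tlift (fun (v : V) (w : W) => tpure (tpure u v : gtens U V) w) x).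
Proof.
split=> [x c u u'|u]; last exact: tlift_linear (gcas_bilin0 u).
rewrite /tlift /= scaler_sumr -big_split; apply: eq_bigr => p _.
by rewrite tpureDl tpureZl tpureDl tpureZl.
Qed.

Lemma gcas_linear : linear gcas_fun.
Proof. exact: tlift_linear gcas_bilin. Qed.

Lemma gcas_funE u v w :
  gcas_fun (tpure u (tpure v w : gtens V W)) = tpure (tpure u v : gtens U V) w.
Proof.
by rewrite /gcas_fun (tlift_pure _ _ gcas_bilin) (tlift_pure _ _ (gcas_bilin0 u)).
Qed.

Lemma gcas_prj a x : gcas_fun (prj a x) = prj a (gcas_fun x).
Proof.
move: a x; apply: (homog_gfun_prj (spans_tens (@spans_homog _ _ U) (spans_tens
  (@spans_homog _ _ V) (@spans_homog _ _ W)))); first exact: gcas_linear.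
move=> _ [u [_ [[a hu] [v [w [[b hv] [c hw] ->]]] ->]]].
exists (a + (b + c)); first by do 2 ?apply: homog_tpure.
by rewrite gcas_funE addrA; do 2 ?apply: homog_tpure.
Qed.

Definition gcas : gmor (gtens U (gtens V W)) (gtens (gtens U V) W) :=
  GMor gcas_linear gcas_prj.

Lemma gascE u v w :
  gasc (tpure (tpure u v : gtens U V) w) = tpure u (tpure v w : gtens V W).
Proof. exact: gasc_funE. Qed.

Lemma gcasE u v w :
  gcas (tpure u (tpure v w : gtens V W)) = tpure (tpure u v : gtens U V) w.
Proof. exact: gcas_funE. Qed.

End Assoc.

Section Unitors.
Variable V : gspace.

Lemma homog_gunit (a : G) (c : gunit k G) : homog a c -> c != 0 -> a = 0.
Proof. by rewrite /homog /=; case: (eqVneq a 0) => // _ <-; rewrite eqxx. Qed.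

Lemma homog_one : homog 0 (1 : gunit k G).
Proof. by rewrite /homog /= eqxx. Qed.

Lemma homog0 (W : gspace) a : homog a (0 : W).
Proof. exact: raddf0. Qed.

Lemma homogZ (W : gspace) a (c : k) (w : W) : homog a w -> homog a (c *: w).
Proof. by rewrite /homog => hw; rewrite linearZ /= hw. Qed.

Lemma glun_bilin : bilin (fun (c : gunit k G) (v : V) => (c : k) *: v).
Proof.
split=> [v c d d'|c d v v'] /=; first by rewrite scalerDl scalerA.
by rewrite scalerDr !scalerA mulrC.
Qed.

Lemma glun_homog a b (c : gunit k G) (v : V) : homog a c -> homog b v ->
  homog (a + b) ((c : k) *: v).
Proof.
move=> hc hv; case: (eqVneq (c : k) 0) => [->|nc].
  by rewrite scale0r; exact: homog0.
by rewrite (homog_gunit hc nc) add0r; exact: homogZ.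
Qed.

Definition glun : gmor (gtens (gunit k G) V) V := gmor_tlift glun_bilin glun_homog.

Lemma glunE (c : gunit k G) v : glun (tpure c v) = (c : k) *: v.
Proof. exact: tlift_pure glun_bilin. Qed.

Lemma grun_bilin : bilin (fun (v : V) (c : gunit k G) => (c : k) *: v).
Proof. by split=> [c|v]; [exact: glun_bilin.2 c|exact: glun_bilin.1 v]. Qed.

Lemma grun_homog a b (v : V) (c : gunit k G) : homog a v -> homog b c ->
  homog (a + b) ((c : k) *: v).
Proof. by move=> hv hc; rewrite addrC; exact: glun_homog. Qed.

Definition grun : gmor (gtens V (gunit k G)) V := gmor_tlift grun_bilin grun_homog.

Lemma grunE v (c : gunit k G) : grun (tpure v c) = (c : k) *: v.
Proof. exact: tlift_pure grun_bilin. Qed.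

Lemma glunV_linear : linear (fun v => tpure (1 : gunit k G) v : gtens _ V).
Proof. exact: (tpure_bilin _ _).2. Qed.

Lemma glunV_prj a (v : V) : tpure (1 : gunit k G) (prj a v) =
  prj a (tpure (1 : gunit k G) v : gtens _ V).
Proof.
move: a v; apply: (@homog_gfun_prj k G V (gtens (gunit k G) V) _
  (fun v => tpure (1 : gunit k G) v) (@spans_homog _ _ V) glunV_linear).
move=> v [a hv]; exists a => //.
by rewrite -[a]add0r; apply: homog_tpure => //; exact: homog_one.
Qed.

Definition glunV : gmor V (gtens (gunit k G) V) := GMor glunV_linear glunV_prj.

Lemma grunV_linear : linear (fun v => tpure v (1 : gunit k G) : gtens V _).
Proof. exact: (tpure_bilin _ _).1. Qed.

Lemma grunV_prj a (v : V) : tpure (prj a v) (1 : gunit k G) =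
  prj a (tpure v (1 : gunit k G) : gtens V _).
Proof.
move: a v; apply: (@homog_gfun_prj k G V (gtens V (gunit k G)) _
  (fun v => tpure v (1 : gunit k G)) (@spans_homog _ _ V) grunV_linear).
move=> v [a hv]; exists a => //.
by rewrite -[a]addr0; apply: homog_tpure => //; exact: homog_one.
Qed.

Definition grunV : gmor V (gtens V (gunit k G)) := GMor grunV_linear grunV_prj.

End Unitors.

(** Multiplicativity in the second argument and invertibility of the values
    follow from these two axioms. *)
Record antisymBichar := AntisymBichar {
  bichar :> G -> G -> k;
  bichar_antisym : forall a b, bichar a b * bichar b a = 1;
  bichar_mull : forall a b c, bichar (a + b) c = bichar a c * bichar b c
}.

Section Color.
Variable chi : antisymBichar.

Lemma bichar_neq0 a b : chi a b != 0.
Proof.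
apply/eqP => h; have := bichar_antisym chi a b.
by rewrite h mul0r => /eqP; rewrite eq_sym oner_eq0.
Qed.

Lemma bichar_mulr a b c : chi a (b + c) = chi a b * chi a c.
Proof.
have E x y : chi x y = (chi y x)^-1.
  apply: (mulIf (bichar_neq0 y x)).
  by rewrite bichar_antisym mulVf // bichar_neq0.
by rewrite E bichar_mull invfM -!E.
Qed.

Section Csym.
Variables V W : gspace.

(** [v ⊗ w |-> \sum_(a, b) chi a b *: w_b ⊗ v_a] *)
Definition csym0 (v : V) (w : W) : gtens W V :=
  gsum (fun a (v' : V) => gsum (fun b (w' : W) => chi a b *: tpure w' v') w) v.

Lemma csym0_bilin : bilin csym0.
Proof.
split=> [w|v].
  apply: gsum_linear => a c u u'; rewrite /gsum /= scaler_sumr -big_split.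
  apply: eq_bigr => b _.
  by rewrite tpureDr tpureZr scalerDr !scalerA [c * _]mulrC.
move=> c w w'; rewrite /csym0 {1 3}/gsum /= [in RHS]/gsum scaler_sumr -big_split.
apply: eq_bigr => a _; rewrite /=.
apply: (@gsum_linear _ _ W (gtens W V)) => b d u u'.
by rewrite tpureDl tpureZl scalerDr !scalerA [d * _]mulrC.
Qed.

Lemma csym0E a b v w : homog a v -> homog b w ->
  csym0 v w = chi a b *: tpure w v.
Proof.
move=> hv hw; rewrite /csym0 (gsum_homog _ hv); last first.
  by move=> c; rewrite /gsum big1 // => d _; rewrite tpure0r scaler0.
by rewrite (gsum_homog _ hw) // => c; rewrite tpure0l scaler0.
Qed.

Lemma csym0_homog a b v w : homog a v -> homog b w -> homog (a + b) (csym0 v w).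
Proof.
move=> hv hw; rewrite (csym0E hv hw) addrC.
by apply: homogZ; exact: homog_tpure.
Qed.

Definition csym : gmor (gtens V W) (gtens W V) :=
  gmor_tlift csym0_bilin csym0_homog.

Lemma csymE a b v w : homog a v -> homog b w ->
  csym (tpure v w) = chi a b *: tpure w v.
Proof.
by move=> hv hw; rewrite [LHS](tlift_pure _ _ csym0_bilin); exact: csym0E.
Qed.

End Csym.

Let h1 V := @spans_homog _ _ V.
Let h2 V W := spans_tens (@h1 V) (@h1 W).
Let h3 U V W := spans_tens (@h2 U V) (@h1 W).
Let h4 U V W T := spans_tens (@h3 U V W) (@h1 T).
Let h3' U V W := spans_tens (@h1 U) (@h2 V W).

Lemma gcompE U V W (g : gmor V W) (f : gmor U V) u : gcomp g f u = g (f u).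
Proof. by []. Qed.

Lemma gidE V (v : V) : gid V v = v.
Proof. by []. Qed.

Lemma gaddE V W (f f' : gmor V W) v : (f + f') v = f v + f' v.
Proof. by []. Qed.

Lemma gmorZ V W (f : gmor V W) c v : f (c *: v) = c *: f v.
Proof. exact: linearZ. Qed.

Let cE := (gcompE, gidE, gaddE).

Lemma gcompA U V W T (h : gmor W T) (g : gmor V W) (f : gmor U V) :
  gcomp h (gcomp g f) = gcomp (gcomp h g) f.
Proof. exact: gmorP. Qed.

Lemma gcomp1m V W (f : gmor V W) : gcomp (gid W) f = f.
Proof. exact: gmorP. Qed.

Lemma gcompm1 V W (f : gmor V W) : gcomp f (gid V) = f.
Proof. exact: gmorP. Qed.

Lemma gcompDl U V W (g g' : gmor V W) (f : gmor U V) :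
  gcomp (g + g') f = gcomp g f + gcomp g' f.
Proof. exact: gmorP. Qed.

Lemma gcompDr U V W (g : gmor V W) (f f' : gmor U V) :
  gcomp g (f + f') = gcomp g f + gcomp g f'.
Proof. by apply: gmorP => u; exact: raddfD. Qed.

Lemma gten1 V W : gten (gid V) (gid W) = gid (gtens V W).
Proof. by apply: (gmor_ext (@h2 V W)) => _ [v [w [_ _ ->]]]; rewrite gtenE. Qed.

Lemma gten_comp V V' V'' W W' W'' (f' : gmor V' V'') (f : gmor V V')
    (g' : gmor W' W'') (g : gmor W W') :
  gten (gcomp f' f) (gcomp g' g) = gcomp (gten f' g') (gten f g).
Proof.
by apply: (gmor_ext (@h2 V W)) => _ [v [w [_ _ ->]]]; rewrite !(cE, gtenE).
Qed.

Lemma gtenDl V V' W W' (f f' : gmor V V') (g : gmor W W') :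
  gten (f + f') g = gten f g + gten f' g.
Proof.
by apply: (gmor_ext (@h2 V W)) => _ [v [w [_ _ ->]]];
  rewrite !(cE, gtenE) tpureDl.
Qed.

Lemma gtenDr V V' W W' (f : gmor V V') (g g' : gmor W W') :
  gten f (g + g') = gten f g + gten f g'.
Proof.
by apply: (gmor_ext (@h2 V W)) => _ [v [w [_ _ ->]]];
  rewrite !(cE, gtenE) tpureDr.
Qed.

Lemma gascK U V W : gcomp (gcas U V W) (gasc U V W) = gid _.
Proof.
apply: (gmor_ext (@h3 U V W)) => _ [_ [w [[u [v [_ _ ->]]] _ ->]]].
by rewrite !cE gascE gcasE.
Qed.

Lemma gcasK U V W : gcomp (gasc U V W) (gcas U V W) = gid _.
Proof.
apply: (gmor_ext (@h3' U V W)) => _ [u [_ [_ [v [w [_ _ ->]]] ->]]].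
by rewrite !cE gcasE gascE.
Qed.

Lemma gasc_nat U U' V V' W W' (f : gmor U U') (g : gmor V V') (h : gmor W W') :
  gcomp (gasc U' V' W') (gten (gten f g) h) =
  gcomp (gten f (gten g h)) (gasc U V W).
Proof.
apply: (gmor_ext (@h3 U V W)) => _ [_ [w [[u [v [_ _ ->]]] _ ->]]].
by rewrite !cE gascE !gtenE gascE.
Qed.

Lemma glunK V : gcomp (glunV V) (glun V) = gid _.
Proof.
apply: (gmor_ext (@h2 (gunit k G) V)) => _ [c [v [_ _ ->]]].
rewrite !cE glunE gmorZ -[glunV V v]/(tpure (1 : gunit k G) v) -tpureZl.
by congr tpure; exact: mulr1.
Qed.

Lemma glunVK V : gcomp (glun V) (glunV V) = gid _.
Proof. by apply: gmorP => v; rewrite [LHS]glunE; exact: scale1r. Qed.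

Lemma glun_nat V W (f : gmor V W) :
  gcomp (glun W) (gten (gid _) f) = gcomp f (glun V).
Proof.
apply: (gmor_ext (@h2 (gunit k G) V)) => _ [c [v [_ _ ->]]].
by rewrite !cE gtenE !glunE gmorZ.
Qed.

Lemma grunK V : gcomp (grunV V) (grun V) = gid _.
Proof.
apply: (gmor_ext (@h2 V (gunit k G))) => _ [v [c [_ _ ->]]].
rewrite !cE grunE gmorZ -[grunV V v]/(tpure v (1 : gunit k G)) -tpureZr.
by congr tpure; exact: mulr1.
Qed.

Lemma grunVK V : gcomp (grun V) (grunV V) = gid _.
Proof. by apply: gmorP => v; rewrite [LHS]grunE; exact: scale1r. Qed.

Lemma grun_nat V W (f : gmor V W) :
  gcomp (grun W) (gten f (gid _)) = gcomp f (grun V).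
Proof.
apply: (gmor_ext (@h2 V (gunit k G))) => _ [v [c [_ _ ->]]].
by rewrite !cE gtenE !grunE gmorZ.
Qed.

Lemma gpentagon U V W T :
  gcomp (gasc U V (gtens W T)) (gasc (gtens U V) W T) =
  gcomp (gten (gid U) (gasc V W T))
        (gcomp (gasc U (gtens V W) T) (gten (gasc U V W) (gid T))).
Proof.
apply: (gmor_ext (@h4 U V W T)).
move=> _ [_ [t [[_ [w [[u [v [_ _ ->]]] _ ->]]] _ ->]]].
by rewrite !cE gtenE !cE !gascE gtenE gascE.
Qed.

Lemma gtriangle V W :
  gcomp (gten (gid V) (glun W)) (gasc V (gunit k G) W) =
  gten (grun V) (gid W).
Proof.
apply: (gmor_ext (@h3 V (gunit k G) W)) => _ [_ [w [[v [c [_ _ ->]]] _ ->]]].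
by rewrite !cE gascE !gtenE glunE grunE !cE tpureZl tpureZr.
Qed.

Lemma csymK V W : gcomp (csym W V) (csym V W) = gid _.
Proof.
apply: (gmor_ext (@h2 V W)) => _ [v [w [[a hv] [b hw] ->]]].
rewrite !cE (csymE hv hw) gmorZ (csymE hw hv) scalerA bichar_antisym.
exact: scale1r.
Qed.

Lemma csym_nat V V' W W' (f : gmor V V') (g : gmor W W') :
  gcomp (csym V' W') (gten f g) = gcomp (gten g f) (csym V W).
Proof.
apply: (gmor_ext (@h2 V W)) => _ [v [w [[a hv] [b hw] ->]]].
rewrite !cE gtenE (csymE hv hw) gmorZ [gten _ _ _ in RHS]gtenE.
exact: csymE (gmor_homog f hv) (gmor_homog g hw).
Qed.

Lemma ghexagon U V W :
  gcomp (gasc V W U) (gcomp (csym U (gtens V W)) (gasc U V W)) =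
  gcomp (gten (gid V) (csym U W))
        (gcomp (gasc V U W) (gten (csym U V) (gid W))).
Proof.
apply: (gmor_ext (@h3 U V W)).
move=> _ [_ [w [[u [v [[a hu] [b hv] ->]]] [c hw] ->]]].
rewrite !cE gascE (csymE hu (homog_tpure hv hw)) gmorZ.
rewrite [gasc _ _ _ _ in LHS]gascE gtenE (csymE hu hv) tpureZl.
rewrite gmorZ [gasc _ _ _ _]gascE gmorZ [gten _ _ _ in RHS]gtenE.
by rewrite (csymE hu hw) tpureZr scalerA bichar_mulr.
Qed.

(** The category of [(G, chi)]-color vector spaces. *)
Definition colorCat : smCat := @SMCat gspace
  (fun V W => gmor V W) (@gid k G) (@gcomp k G) (@gtens k G) gten (gunit k G)
  gasc gcas glun glunV grun grunV csym
  gcompA gcomp1m gcompm1 gcompDl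
  gcompDr gten1 gten_comp gtenDl gtenDr gascK gcasK gasc_nat glunK glunVK
  glun_nat grunK grunVK grun_nat gpentagon gtriangle csymK csym_nat ghexagon.

End Color.
End GMorTens.

Notation "v ⊗ w" := (tpure v w) : ring_scope.

(** * The objects [f] and [L(1, n)] *)

(** The graded vector space with homogeneous basis [bvec i] of degree [deg i]. *)
Section FreeSpace.
Variables (k : fieldType) (G : zmodType) (I : finType) (deg : I -> G).

Definition free_prj (a : G) (v : {ffun I -> k^o}) : {ffun I -> k^o} :=
  [ffun i => if deg i == a then v i else 0].

Lemma free_prj_linear a : linear (free_prj a).
Proof.
by move=> c u v; apply/ffunP => i; rewrite !ffunE;
  case: eqP => // _; rewrite scaler0 addr0.
Qed.

Lemma free_prj_prj a b v :
  free_prj a (free_prj b v) = if a == b then free_prj b v else 0.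
Proof.
apply/ffunP => i; rewrite !ffunE; case: (eqVneq a b) => [->|nab].
  by rewrite ffunE; case: eqP.
by rewrite ffunE; case: eqP => // ->; rewrite (negPf nab).
Qed.

Lemma free_prj_fin v :
  exists s : seq G, v = \sum_(a <- undup s) free_prj a v.
Proof.
exists (codom deg); apply/ffunP => i; rewrite sum_ffunE.
rewrite (bigD1_seq (deg i)) ?undup_uniq ?mem_undup ?codom_f //= ffunE eqxx.
by rewrite big1 ?addr0 // => a na; rewrite ffunE eq_sym (negPf na).
Qed.

Definition freeSpace : gspace k G :=
  GSpace free_prj_linear free_prj_prj free_prj_fin.

Definition bvec (i : I) : freeSpace := [ffun j => (j == i)%:R] : {ffun I -> k^o}.

End FreeSpace.

Section Objects.
Variables (k : fieldType) (G : zmodType).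

Definition Fspace : gspace k G := freeSpace k (fun _ : 'I_2 => 0).

Definition svec : Fspace := bvec k (fun _ : 'I_2 => 0) 0.
Definition tvec : Fspace := bvec k (fun _ : 'I_2 => 0) 1.

Definition Fbialg (chi : antisymBichar k G) :
    lieBialgebra (zeroCartier (colorCat chi)) :=
  trivialLie (Fspace : colorCat chi).

Variables (g h : G) (n : nat).

Definition Ldeg (i : 'I_2 + 'I_n.+1) : G :=
  match i with inl _ => g | inr j => g *+ j + h end.

Definition Lspace : gspace k G := freeSpace k Ldeg.

Definition x1 : Lspace := bvec k Ldeg (inl 0).
Definition x2 : Lspace := bvec k Ldeg (inl 1).

(** [zvec i = 0] unless [0 <= i <= n]. *)
Definition zvec (i : int) : Lspace :=
  match i with
  | Posz j => if insub j is Some j' then bvec k Ldeg (inr j') else 0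
  | Negz _ => 0
  end.

Definition L0 : {vspace {ffun 'I_2 + 'I_n.+1 -> k^o}} :=
  <<(x1 : {ffun 'I_2 + 'I_n.+1 -> k^o})
    :: [seq (zvec j : {ffun 'I_2 + 'I_n.+1 -> k^o}) | j : nat <- iota 0 n.+1]>>%VS.

End Objects.

(* Main.v *)
From HB Require Import structures.
Require Import Defs.
From mathcomp Require Import all_boot all_order all_algebra.
From mathcomp Require Import ring.

(** Everything happens on weight vectors.  As [f] has zero bracket and cobracket
    and lives in degree [0], the symmetry moves it across other objects without
    a coefficient.  Call [v] of weight [a : f] when [lambda v = a ⊗ v].  If [V]
    is spanned by weight vectors, then the comodule axiom is automatic, and [V]
    is a crossed module as soon as the operators [b.] commute and preserve
    weights ([crossed_module_weight]); a linear map is a morphism as soon as it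
    commutes with these operators and preserves weights
    ([crossed_morphism_weight]); weights add under tensor products
    ([weight_tens]); and on homogeneous vectors of weights [a], [b] the
    infinitesimal braiding is [u ⊗ v |-> b.u ⊗ v + u ⊗ a.v] ([eta_hatE]).

    In [L(1, n)] the vectors [x_1], [x_2] have weight [s] and [z_i] has weight
    [i s + t].  The bracket and the cobracket preserve weights because
    [s + (i s + t) = (i+1) s + t].  They commute with the operators because all
    expressions vanish: the operators map [x_2] to multiples of [x_1] and kill
    the other generators, while the bracket and the cobracket kill [x_1] and
    produce only [z]'s, respectively tensors of [x_1] with [z]'s.

    Two [x]'s commute without a coefficient because [chi g g = 1], and [x_a],
    [z_i] commute up to [c = chi g h], independently of [i]; on two [z]'s both
    sides of every identity vanish.  In the Jacobi identity only two [x_2] and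
    one [z_i] give nonzero terms, which are two multiples of [z_(i+2)] with the
    same power of [c] and cancel; in the co-Jacobi
    identity the cobracket is nonzero only on the [z]-factor of [delta z_i].

    The heart is the compatibility condition at [x_2 ⊗ z_i].  Put
    [S_i = (tau - id)(x_1 ⊗ z_i)], so that [delta z_i = d_i S_(i-1)] with
    [d_i = i(i-1-n)/2].  The left side is [delta z_(i+1) = d_(i+1) S_i].  On the
    right, the term built from bracket and cobracket ([cross]) contributes [d_i S_i], and
    the infinitesimal braiding, which sends [x_2 ⊗ z_i] to
    [(i s + t).x_2 ⊗ z_i = (i - n/2) x_1 ⊗ z_i], contributes [(i - n/2) S_i].
    The two sides agree because [d_(i+1) = d_i + i - n/2] ([cobr_coefS]): the
    coefficients [d_i] are the partial sums of the scalars [i - n/2].  The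
    string stops at [z_n] consistently because [d_(n+1) = 0], which lets every
    formula be stated for [z_i] with arbitrary [i : nat]. *)

Set Implicit Arguments.
Unset Strict Implicit.
Unset Printing Implicit Defensive.

Import GRing.Theory.
Local Open Scope ring_scope.

(* Lets [/=] translate the operations of [colorCat] into graded maps while
   keeping the application of a map to a vector folded. *)
#[local] Arguments gfun : simpl never.
#[local] Arguments gsort : simpl never.

(** * Evaluation on pure tensors *)

Section Evaluation.
Variables (k : fieldType) (G : zmodType) (chi : antisymBichar k G).
Implicit Types U V W : gspace k G.

Lemma gmorD V W (f : gmor V W) u v : f (u + v) = f u + f v.
Proof. exact: raddfD. Qed.

Lemma gmorN V W (f : gmor V W) u : f (- u) = - f u.
Proof. exact: raddfN. Qed.

Lemma gmorB V W (f : gmor V W) u v : f (u - v) = f u - f v.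
Proof. exact: raddfB. Qed.

Lemma gmor0 V W (f : gmor V W) : f 0 = 0.
Proof. exact: raddf0. Qed.

Lemma goppE V W (f : gmor V W) v : (- f) v = - f v.
Proof. by []. Qed.

Lemma gzeroE V W v : (0 : gmor V W) v = 0.
Proof. by []. Qed.

Lemma tpureNl (V W : lmodType k) (v : V) (w : W) : (- v) ⊗ w = - (v ⊗ w).
Proof. by rewrite -scaleN1r tpureZl scaleN1r. Qed.

Lemma tpureNr (V W : lmodType k) (v : V) (w : W) : v ⊗ (- w) = - (v ⊗ w).
Proof. by rewrite -scaleN1r tpureZr scaleN1r. Qed.

Lemma bichar0l a : chi 0 a = 1.
Proof.
apply: (mulIf (bichar_neq0 chi 0 a)).
by rewrite -bichar_mull addr0 mul1r.
Qed.

Lemma bicharV a b : chi b a = (chi a b)^-1.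
Proof.
apply: (mulIf (bichar_neq0 chi a b)).
by rewrite bichar_antisym mulVf // bichar_neq0.
Qed.

Lemma bichar_mulrn a b i : chi a (b *+ i) = chi a b ^+ i.
Proof.
elim: i => [|i IH]; last by rewrite mulrS bichar_mulr IH exprS.
by rewrite mulr0n bicharV bichar0l invr1.
Qed.

End Evaluation.

Definition evalE := (gcompE, gidE, gaddE, goppE, gzeroE, gtenE, gascE, gcasE).
Definition linE := (gmorD, gmorN, gmorZ, gmor0,
  tpureDl, tpureDr, tpureNl, tpureNr, tpureZl, tpureZr).

(** * Extending maps from a homogeneous basis *)

Section FreeMorphisms.
Variables (k : fieldType) (G : zmodType).
Variables (I : finType) (deg : I -> G).
Notation V := (freeSpace k deg).

Lemma bvec_homog i : homog (deg i) (bvec k deg i).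
Proof.
apply/ffunP => j; rewrite !ffunE.
by case: (eqVneq j i) => [->|_]; rewrite ?eqxx //; case: ifP.
Qed.

Lemma free_expand (v : V) : v = \sum_i (v : {ffun I -> k^o}) i *: bvec k deg i.
Proof.
apply/ffunP => j; rewrite sum_ffunE (bigD1 j) //= big1 => [|i nij].
  by rewrite !ffunE eqxx addr0; exact/esym/mulr1.
by rewrite !ffunE eq_sym (negPf nij); exact: mulr0.
Qed.

Lemma spans_bvec : spans (fun v : V => exists i, v = bvec k deg i).
Proof.
move=> U f f' lf lf' H v.
pose F := HB.pack_for {linear V -> U} f (GRing.isLinear.Build _ _ _ _ _ lf).
pose F' := HB.pack_for {linear V -> U} f' (GRing.isLinear.Build _ _ _ _ _ lf').
rewrite (free_expand v) -[LHS]/(F _) -[RHS]/(F' _) !linear_sum.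
by apply: eq_bigr => i _; rewrite !linearZ; congr (_ *: _); apply: H; exists i.
Qed.

Definition free_fun (U : gspace k G) (F : I -> U) (v : V) : U :=
  \sum_i (v : {ffun I -> k^o}) i *: F i.

Lemma free_fun_linear U F : linear (@free_fun U F).
Proof.
move=> c u v; rewrite scaler_sumr -big_split; apply: eq_bigr => i _.
by rewrite !ffunE scalerDl scalerA.
Qed.

Lemma free_funE U F i : @free_fun U F (bvec k deg i) = F i.
Proof.
rewrite /free_fun (bigD1 i) //= big1 => [|j nji]; rewrite ffunE.
  by rewrite eqxx scale1r addr0.
by rewrite (negPf nji) scale0r.
Qed.

Section Extension.
Variables (U : gspace k G) (F : I -> U).
Hypothesis homF : forall i, homog (deg i) (F i).

Lemma free_fun_prj a v : free_fun F (prj a v) = prj a (free_fun F v).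
Proof.
move: a v; apply: (homog_gfun_prj spans_bvec); first exact: free_fun_linear.
move=> _ [i ->]; exists (deg i); first exact: bvec_homog.
by rewrite free_funE; exact: homF.
Qed.

Definition free_mor : gmor V U := GMor (@free_fun_linear U F) free_fun_prj.

Lemma free_morE i : free_mor (bvec k deg i) = F i.
Proof. exact: free_funE. Qed.

End Extension.

End FreeMorphisms.

Section BilinearExtension.
Variables (k : fieldType) (G : zmodType).
Variables (I J : finType) (deg : I -> G) (deg' : J -> G).
Variables (U : gspace k G) (B : I -> J -> U).
Notation V := (freeSpace k deg).
Notation W := (freeSpace k deg').

Definition free_bil (v : V) (w : W) : U :=
  \sum_i (v : {ffun I -> k^o}) i *:
    \sum_j (w : {ffun J -> k^o}) j *: B i j.

Lemma free_bil_bilin : bilin free_bil.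
Proof.
split=> [w c u v|v c u w] /=; rewrite /free_bil scaler_sumr -big_split;
  apply: eq_bigr => i _ /=; first by rewrite !ffunE scalerDl scalerA.
rewrite scalerA mulrC -scalerA -scalerDr; congr (_ *: _).
rewrite scaler_sumr -big_split; apply: eq_bigr => j _ /=.
by rewrite !ffunE scalerDl scalerA.
Qed.

Lemma free_bilE i j : free_bil (bvec k deg i) (bvec k deg' j) = B i j.
Proof.
rewrite /free_bil (bigD1 i) //= [X in _ + X]big1 => [|l nli].
  rewrite ffunE eqxx scale1r addr0 (bigD1 j) //= big1 => [|m nmj].
    by rewrite ffunE eqxx scale1r addr0.
  by rewrite ffunE (negPf nmj) scale0r.
by rewrite ffunE (negPf nli) scale0r.
Qed.

Hypothesis homB : forall i j, homog (deg i + deg' j) (B i j).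

Lemma free_bil_prj a (x : gtens V W) :
  tlift free_bil (prj a x) = prj a (tlift free_bil x).
Proof.
move: a x; apply: (homog_gfun_prj
  (spans_tens (@spans_bvec k G I deg) (@spans_bvec k G J deg'))).
  exact: tlift_linear free_bil_bilin.
move=> _ [_ [_ [[i ->] [j ->] ->]]]; exists (deg i + deg' j).
  by apply: homog_tpure; exact: bvec_homog.
by rewrite (tlift_pure _ _ free_bil_bilin) free_bilE; exact: homB.
Qed.

Definition free_mor2 : gmor (gtens V W) U :=
  @GMor k G (gtens V W) U (tlift free_bil)
    (tlift_linear free_bil_bilin) free_bil_prj.

Lemma free_mor2E i j :
  free_mor2 (bvec k deg i ⊗ bvec k deg' j) = B i j.
Proof. by rewrite [LHS](tlift_pure _ _ free_bil_bilin) free_bilE. Qed.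

End BilinearExtension.

(** * Crossed modules over an abelian Lie bialgebra of degree zero *)

Section Weights.
Variables (k : fieldType) (G : zmodType) (chi : antisymBichar k G).
Notation F := (Fspace k G).
Notation C := (zeroCartier (colorCat chi)).
Notation f := (Fbialg chi).
Implicit Types (U V W : gspace k G) (a b : F).

Lemma Fspace_homog a : homog 0 a.
Proof. by apply/ffunP => i; rewrite ffunE eqxx. Qed.

Lemma csymF V a (v : V) : csym chi F V (a ⊗ v) = v ⊗ a.
Proof.
move: v; apply: (@spans_homog _ _ V (gtens V F)
  (fun v => csym chi F V (a ⊗ v)) (fun v => v ⊗ a)).
- by move=> c u v; rewrite tpureDr tpureZr gmorD gmorZ.
- by move=> c u v; rewrite tpureDl tpureZl.
move=> v [p hv].
by rewrite (csymE chi (Fspace_homog a) hv) bichar0l scale1r.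
Qed.

Lemma csymFr V a (v : V) : csym chi V F (v ⊗ a) = a ⊗ v.
Proof. by rewrite -csymF -gcompE csymK. Qed.

Definition weight V (coact : gmor V (gtens F V)) (v : V) (a : F) :=
  coact v = a ⊗ v.

Lemma weight0 V (coact : gmor V (gtens F V)) a : weight coact 0 a.
Proof. by rewrite /weight gmor0 tpure0r. Qed.

Lemma weightZ V (coact : gmor V (gtens F V)) d v a :
  weight coact v a -> weight coact (d *: v) a.
Proof. by rewrite /weight gmorZ tpureZr => ->. Qed.

Lemma weightB V (coact : gmor V (gtens F V)) u v a :
  weight coact u a -> weight coact v a -> weight coact (u - v) a.
Proof. by rewrite /weight gmorD gmorN tpureDr tpureNr => -> ->. Qed.

(** [f] acts on tensor products by derivations, without coefficients since its
    degree is [0]. *)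
Lemma ten_actE V W (actV : gmor (gtens F V) V) (actW : gmor (gtens F W) W)
    a (v : V) (w : W) :
  (@ten_act C f V W actV actW : gmor _ (gtens V W)) (a ⊗ (v ⊗ w)) =
  actV (a ⊗ v) ⊗ w + v ⊗ actW (a ⊗ w).
Proof. by rewrite /ten_act /= !evalE csymF !evalE. Qed.

Lemma weight_tens V W (coactV : gmor V (gtens F V)) (coactW : gmor W (gtens F W))
    (v : V) (w : W) a b :
  weight coactV v a -> weight coactW w b ->
  @weight (gtens V W) (@ten_coact C f V W coactV coactW) (v ⊗ w) (a + b).
Proof.
rewrite /weight /ten_coact /= => hv hw.
by rewrite !evalE hv hw !evalE csymFr !evalE tpureDl.
Qed.

(** The comodule axiom holds since [(id - tau) (a ⊗ a) = 0] in degree [0], and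
    the third axiom reads [lambda (b.v) = a ⊗ b.v] for [v] of weight [a]. *)
Lemma crossed_module_weight V (act : gmor (gtens F V) V)
    (coact : gmor V (gtens F V)) (P : V -> Prop) : spans P ->
  (forall v, P v -> exists a, weight coact v a /\
     forall b, weight coact (act (b ⊗ v)) a) ->
  (forall a b v, P v -> act (a ⊗ act (b ⊗ v)) = act (b ⊗ act (a ⊗ v))) ->
  @crossed_module C f V act coact.
Proof.
move=> sP wP comm; split=> /=.
- apply: (gmor_ext
    (spans_tens (spans_tens (@spans_all _ _ F) (@spans_all _ _ F)) sP)).
  move=> _ [_ [v [[a [b [_ _ ->]]] Pv ->]]].
  rewrite !evalE csymF linE !evalE tpure0l gmor0.
  by rewrite !linE !evalE (comm a b) ?subrr.
- apply: (gmor_ext sP) => v /wP [a [wv _]].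
  by rewrite !evalE wv !evalE wv !evalE csymF tpure0l subrr.
apply: (gmor_ext (spans_tens (@spans_all _ _ F) sP))
  => _ [b [v [_ /wP [a [wv wbv]] ->]]].
by rewrite !evalE wbv wv !evalE csymF !evalE !tpure0l !linE !(addr0, add0r, oppr0).
Qed.

Lemma crossed_morphism_weight V W
    (actV : gmor (gtens F V) V) (coactV : gmor V (gtens F V))
    (actW : gmor (gtens F W) W) (coactW : gmor W (gtens F W))
    (p : gmor V W) (P : V -> Prop) : spans P ->
  (forall a v, P v -> p (actV (a ⊗ v)) = actW (a ⊗ p v)) ->
  (forall v, P v -> exists a, weight coactV v a /\ weight coactW (p v) a) ->
  @crossed_morphism C f V W actV coactV actW coactW p.
Proof.
move=> sP eqP wP; split=> /=.
  apply: (gmor_ext (spans_tens (@spans_all _ _ F) sP)) => _ [a [v [_ Pv ->]]].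
  by rewrite !evalE eqP.
apply: (gmor_ext sP) => v /wP [a [wv wpv]].
by rewrite !evalE wv wpv !evalE.
Qed.

(** In each of the two [zeta] terms [v] and [w] are exchanged twice, once inside
    [zeta], so the coefficients [chi] cancel. *)
Lemma eta_hatE V W
    (actV : gmor (gtens F V) V) (coactV : gmor V (gtens F V))
    (actW : gmor (gtens F W) W) (coactW : gmor W (gtens F W))
    p q (v : V) (w : W) a b :
  homog p v -> homog q w -> weight coactV v a -> weight coactW w b ->
  (@eta_hat C f V W actV coactV actW coactW : gmor (gtens V W) _) (v ⊗ w) =
  actV (b ⊗ v) ⊗ w + v ⊗ actW (a ⊗ w).
Proof.
move=> hv hw wv ww; rewrite /eta_hat /zeta /= !evalE addr0.
have haw : homog q (actW (a ⊗ w)).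
  by apply: gmor_homog; rewrite -[q]add0r; apply: homog_tpure (Fspace_homog a) hw.
rewrite wv (csymE chi hv hw) !(linE, evalE) ww !evalE.
rewrite (csymE chi hv hw) (csymE chi hw hv) !(linE, evalE) (csymE chi haw hv).
by rewrite !scalerA !bichar_antisym !scale1r.
Qed.

End Weights.

(** * The structure maps of [L(1, n)] on generators *)

Section Construction.
Variables (k : fieldType) (G : zmodType) (g h : G) (chi : antisymBichar k G).
Variable n : nat.
Hypothesis two_neq0 : 2%:R != 0 :> k.
Hypothesis chi_gg : chi g g = 1.

Notation F := (Fspace k G).
Notation C := (zeroCartier (colorCat chi)).
Notation f := (Fbialg chi).
Notation L := (Lspace k g h n).
Notation s := (svec k G).
Notation t := (tvec k G).
Notation x1 := (x1 k g h n).
Notation x2 := (x2 k g h n).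
Notation c := (chi g h).
Notation e := (bvec k (@Ldeg G g h n)).

Definition znat (i : nat) : L := zvec k g h n i.
Notation z := znat.

Lemma z_ord (j : 'I_n.+1) : z j = e (inr j).
Proof. by rewrite /znat /= valK. Qed.

Lemma z_out i : (n < i)%N -> z i = 0.
Proof. by move=> ni; rewrite /znat /= insubN // -leqNgt. Qed.

Lemma z_split i : (n < i)%N \/ exists2 j : 'I_n.+1, i = j & z i = e (inr j).
Proof.
have [le_in|lt_ni] := leqP i n; last by left.
by right; exists (Ordinal (le_in : (i < n.+1)%N)) => //; rewrite -z_ord.
Qed.

(** Indexing the [z_i] by all naturals, with repeated zeros beyond [n], keeps the
    successor [z_i |-> z_(i+1)] inside the family. *)
Inductive generator : L -> Prop :=
| gen_x1 : generator x1
| gen_x2 : generator x2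
| gen_z i : generator (z i).

Lemma spans_generator : spans generator.
Proof.
move=> U p p' lp lp' H; apply: spans_bvec => // _ [[i|j] ->]; apply: H; last first.
  by rewrite -z_ord; exact: gen_z.
case: i => [[|[|//]] lti].
  by rewrite (_ : Ordinal lti = 0); [exact: gen_x1|exact: val_inj].
by rewrite (_ : Ordinal lti = 1); [exact: gen_x2|exact: val_inj].
Qed.

Lemma x1_homog : homog g x1.
Proof. exact: (bvec_homog k (@Ldeg G g h n) (inl 0)). Qed.

Lemma x2_homog : homog g x2.
Proof. exact: (bvec_homog k (@Ldeg G g h n) (inl 1)). Qed.

Lemma z_homog i : homog (g *+ i + h) (z i).
Proof.
case: (z_split i) => [/z_out ->|[j -> ->]]; first exact: homog0.
exact: (bvec_homog k (@Ldeg G g h n) (inr j)).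
Qed.

(** Since [chi g g = 1], the coefficient between [x_a] and [z_i] is the same for
    all [i]. *)
Lemma chi_gz i : chi g (g *+ i + h) = c.
Proof. by rewrite bichar_mulr bichar_mulrn chi_gg expr1n mul1r. Qed.

Lemma tau_xz x : homog g x -> forall i,
  csym chi L L (x ⊗ z i) = c *: (z i ⊗ x).
Proof. by move=> hx i; rewrite (csymE chi hx (z_homog i)) chi_gz. Qed.

Lemma tau_zx x : homog g x -> forall i,
  csym chi L L (z i ⊗ x) = c^-1 *: (x ⊗ z i).
Proof. by move=> hx i; rewrite (csymE chi (z_homog i) hx) bicharV chi_gz. Qed.

Lemma tau_xx x y : homog g x -> homog g y -> csym chi L L (x ⊗ y) = y ⊗ x.
Proof. by move=> hx hy; rewrite (csymE chi hx hy) chi_gg scale1r. Qed.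

Lemma tau_zz i j : csym chi L L (z i ⊗ z j) =
  chi (g *+ i + h) (g *+ j + h) *: (z j ⊗ z i).
Proof. exact: csymE (z_homog i) (z_homog j). Qed.

Definition tauE := (tau_xz x1_homog, tau_xz x2_homog, tau_zx x1_homog,
  tau_zx x2_homog, tau_xx x1_homog x1_homog, tau_xx x1_homog x2_homog,
  tau_xx x2_homog x1_homog, tau_xx x2_homog x2_homog, tau_zz).

Definition act_basis (i : 'I_2) (j : 'I_2 + 'I_n.+1) : L :=
  if j == inl 1 then (if i == 0 then 1 else - (n%:R / 2%:R)) *: x1 else 0.

Lemma act_basis_homog i j : homog (0 + Ldeg g h j) (act_basis i j).
Proof.
rewrite add0r /act_basis; case: eqP => [->|_]; last exact: homog0.
by apply: homogZ; exact: x1_homog.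
Qed.

Definition act : gmor (gtens F L) L := free_mor2 act_basis_homog.

(** The action is [a.x_2 = psi a x_1], zero on the other generators. *)
Definition psi (a : F) : k :=
  (a : {ffun 'I_2 -> k^o}) 0 - n%:R / 2%:R * (a : {ffun 'I_2 -> k^o}) 1.

Lemma act_basisE (a : F) j :
  act (a ⊗ e j) = if j == inl 1 then psi a *: x1 else 0.
Proof.
move: a; apply: (@spans_bvec k G _ (fun _ : 'I_2 => 0) L
  (fun a => act (a ⊗ e j)) (fun a => if j == inl 1 then psi a *: x1 else 0)).
- by move=> d a b; rewrite tpureDl tpureZl gmorD gmorZ.
- move=> d a b; case: ifP => _; last by rewrite scaler0 addr0.
  rewrite scalerA -scalerDl /psi !ffunE; congr (_ *: _).
  by rewrite /GRing.scale /=; ring.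
move=> _ [i ->]; rewrite [LHS](free_mor2E act_basis_homog) /act_basis.
case: ifP => // _; rewrite /psi !ffunE.
by case: i => [[|[|//]] lti] /=; congr (_ *: _); rewrite ?mulr0 ?subr0 ?mulr1 ?sub0r.
Qed.

Lemma act_x1 a : act (a ⊗ x1) = 0.
Proof. by rewrite act_basisE. Qed.

Lemma act_x2 a : act (a ⊗ x2) = psi a *: x1.
Proof. by rewrite act_basisE eqxx. Qed.

Lemma act_z a i : act (a ⊗ z i) = 0.
Proof.
by case: (z_split i) => [/z_out ->|[j _ ->]]; rewrite ?act_basisE // tpure0r gmor0.
Qed.

Lemma psi_s : psi s = 1.
Proof. by rewrite /psi !ffunE /= mulr0 subr0. Qed.

Lemma psi_t : psi t = - (n%:R / 2%:R).
Proof. by rewrite /psi !ffunE /= mulr1 sub0r. Qed.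

Lemma psi_z i : psi (i%:R *: s + t) = i%:R - n%:R / 2%:R.
Proof. by rewrite /psi !ffunE /= /GRing.scale /=; ring. Qed.

Definition coact_basis (j : 'I_2 + 'I_n.+1) : gtens F L :=
  (match j with inl _ => s | inr i => (i : nat)%:R *: s + t end : F) ⊗ e j.

Lemma coact_basis_homog j : homog (Ldeg g h j) (coact_basis j).
Proof.
rewrite -[Ldeg g h j]add0r; apply: homog_tpure; first exact: Fspace_homog.
exact: bvec_homog.
Qed.

Definition coact : gmor L (gtens F L) := free_mor coact_basis_homog.

Lemma weight_x1 : weight coact x1 s.
Proof. exact: (free_morE coact_basis_homog). Qed.

Lemma weight_x2 : weight coact x2 s.
Proof. exact: (free_morE coact_basis_homog). Qed.

Lemma weight_z i : weight coact (z i) (i%:R *: s + t).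
Proof.
rewrite /weight; case: (z_split i) => [/z_out ->|[j -> ->]].
  by rewrite tpure0r gmor0.
exact: (free_morE coact_basis_homog).
Qed.

Definition br_basis (i j : 'I_2 + 'I_n.+1) : L :=
  match i, j with
  | inl a, inr b => if a == 1 then z b.+1 else 0
  | inr b, inl a => if a == 1 then - (c^-1 *: z b.+1) else 0
  | _, _ => 0
  end.

Lemma br_basis_homog i j : homog (Ldeg g h i + Ldeg g h j) (br_basis i j).
Proof.
case: i j => [a|b] [a'|b'] /=; do ?exact: homog0; case: ifP => _;
  do ?exact: homog0.
  by rewrite addrA -mulrS; exact: z_homog.
by rewrite addrAC -mulrSr -scaleNr; apply: homogZ; exact: z_homog.
Qed.

Definition br : gmor (gtens L L) L := free_mor2 br_basis_homog.

Lemma br_e i j : br (e i ⊗ e j) = br_basis i j.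
Proof. exact: free_mor2E. Qed.

Lemma br_xx a b : br (e (inl a) ⊗ e (inl b)) = 0.
Proof. exact: br_e. Qed.

Lemma br_zz i j : br (z i ⊗ z j) = 0.
Proof.
case: (z_split i) => [/z_out ->|[i' _ ->]]; first by rewrite tpure0l gmor0.
case: (z_split j) => [/z_out ->|[j' _ ->]]; first by rewrite tpure0r gmor0.
exact: br_e.
Qed.

Lemma br_x1z i : br (x1 ⊗ z i) = 0.
Proof.
case: (z_split i) => [/z_out ->|[j _ ->]]; first by rewrite tpure0r gmor0.
exact: br_e.
Qed.

Lemma br_zx1 i : br (z i ⊗ x1) = 0.
Proof.
case: (z_split i) => [/z_out ->|[j _ ->]]; first by rewrite tpure0l gmor0.
exact: br_e.
Qed.

Lemma br_x2z i : br (x2 ⊗ z i) = z i.+1.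
Proof.
case: (z_split i) => [lt_ni|[j -> ->]]; last exact: br_e.
by rewrite !z_out ?tpure0r ?gmor0 // ltnW.
Qed.

Lemma br_zx2 i : br (z i ⊗ x2) = - (c^-1 *: z i.+1).
Proof.
case: (z_split i) => [lt_ni|[j -> ->]]; last exact: br_e.
by rewrite !z_out ?tpure0l ?gmor0 ?scaler0 ?oppr0 // ltnW.
Qed.

Definition brE := (br_xx, br_zz, br_x1z, br_zx1, br_x2z, br_zx2).

(** [(tau - id) (x1 ⊗ z i)], with the symmetry evaluated. *)
Definition skew (i : nat) : gtens L L := c *: (z i ⊗ x1) - x1 ⊗ z i.

Definition cobr_coef (i : nat) : k := i%:R * (i%:R - 1 - n%:R) / 2%:R.

Definition cobr_basis (j : 'I_2 + 'I_n.+1) : gtens L L :=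
  match j with
  | inl _ => 0
  | inr i => cobr_coef i *: skew i.-1
  end.

Lemma skew_homog i : homog (g *+ i.+1 + h) (skew i).
Proof.
have hx : homog (g *+ i.+1 + h) (x1 ⊗ z i : gtens L L).
  by rewrite mulrS -addrA; apply: homog_tpure; [exact: x1_homog|exact: z_homog].
have hz : homog (g *+ i.+1 + h) (z i ⊗ x1 : gtens L L).
  rewrite mulrSr addrAC.
  by apply: homog_tpure; [exact: z_homog|exact: x1_homog].
have hNx := homogZ (-1) hx; rewrite scaleN1r in hNx.
by rewrite /homog /skew prj_linear hNx hz.
Qed.

Lemma cobr_coef0 : cobr_coef 0 = 0.
Proof. by rewrite /cobr_coef !mul0r. Qed.

Lemma cobr_basis_homog j : homog (Ldeg g h j) (cobr_basis j).
Proof.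
case: j => [a|[[|i] lti]] /=; first exact: homog0.
  by rewrite cobr_coef0 scale0r; exact: homog0.
by apply: homogZ; exact: skew_homog.
Qed.

Definition cobr : gmor L (gtens L L) := free_mor cobr_basis_homog.

Lemma cobr_e j : cobr (e j) = cobr_basis j.
Proof. exact: free_morE. Qed.

Lemma cobr_x1 : cobr x1 = 0.
Proof. exact: cobr_e. Qed.

Lemma cobr_x2 : cobr x2 = 0.
Proof. exact: cobr_e. Qed.

(** Beyond the basis, the formula survives at [i = n.+1] because
    [cobr_coef n.+1 = 0], and later because [z i.-1 = 0]. *)
Lemma cobr_z i : cobr (z i) = cobr_coef i *: skew i.-1.
Proof.
case: (z_split i) => [lt_ni|[j -> ->]]; last exact: cobr_e.
rewrite z_out // gmor0; case: i lt_ni => // i; rewrite ltnS leq_eqVlt /=.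
case/orP=> [/eqP <-|lt_ni].
  by rewrite /cobr_coef -natr1 addrK subrr mulr0 mul0r scale0r.
by rewrite /skew z_out // tpure0l tpure0r scaler0 subrr scaler0.
Qed.

Definition cobrE := (cobr_x1, cobr_x2, cobr_z).

(** The increment is the scalar by which the weight of [z i] acts on [x2], see
    [psi_z]; this is what makes bracket and cobracket compatible. *)
Lemma cobr_coefS i : cobr_coef i.+1 = cobr_coef i + (i%:R - n%:R / 2%:R).
Proof. by rewrite /cobr_coef -natr1; field. Qed.

(** * Crossed module structure *)

Definition actE := (act_x1, act_x2, act_z).
Definition simplE := (scaler0, scale0r, tpure0l, tpure0r, gmor0, addr0, add0r,
  oppr0, subr0).

(** Products of two operators vanish, as their image lies in the line of [x1],
    which they annihilate; [x1] and [x2] share the weight [s]. *)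
Lemma crossed_module_L : @crossed_module C f L act coact.
Proof.
apply: (crossed_module_weight chi spans_generator).
  move=> _ [||i].
  - exists s; split=> [|b]; first exact: weight_x1.
    by rewrite act_x1 /weight gmor0 tpure0r.
  - exists s; split=> [|b]; first exact: weight_x2.
    by rewrite act_x2 /weight gmorZ tpureZr weight_x1.
  exists (i%:R *: s + t); split=> [|b]; first exact: weight_z.
  by rewrite act_z /weight gmor0 tpure0r.
by move=> a b _ [||i]; rewrite !(actE, linE, simplE).
Qed.

(** Bracketing with [x2] moves [z i] to the weight of [z i.+1], and [delta] splits
    it again. *)
Lemma s_add_weight i : s + (i%:R *: s + t) = i.+1%:R *: s + t.
Proof. by rewrite addrA -{1}[s]scale1r -scalerDl nat1r. Qed.

Lemma br_crossed : @crossed_morphism C f (gtens L L) L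
  (@ten_act C f L L act act) (@ten_coact C f L L coact coact) act coact br.
Proof.
apply: (crossed_morphism_weight chi (spans_tens spans_generator spans_generator)).
- move=> a _ [u [v [gu gv ->]]]; rewrite ten_actE.
  by case: gu; case: gv => *; rewrite !(actE, brE, linE, simplE).
have wt u v a b : weight coact u a -> weight coact v b ->
    weight coact (br (u ⊗ v)) (a + b) ->
  exists a0 : F, @weight _ _ (gtens L L) (@ten_coact C f L L coact coact)
    (u ⊗ v) a0 /\ weight coact (br (u ⊗ v)) a0.
  by move=> wu wv wuv; exists (a + b); split=> //; exact: (weight_tens chi).
move=> _ [_ [_ [[||i] [||j] ->]]].
- by apply: wt weight_x1 weight_x1 _; rewrite brE; exact: weight0.
- by apply: wt weight_x1 weight_x2 _; rewrite brE; exact: weight0.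
- by apply: wt weight_x1 (weight_z j) _; rewrite brE; exact: weight0.
- by apply: wt weight_x2 weight_x1 _; rewrite brE; exact: weight0.
- by apply: wt weight_x2 weight_x2 _; rewrite brE; exact: weight0.
- apply: wt weight_x2 (weight_z j) _.
  by rewrite brE s_add_weight; exact: weight_z.
- by apply: wt (weight_z i) weight_x1 _; rewrite brE; exact: weight0.
- apply: wt (weight_z i) weight_x2 _.
  by rewrite brE addrC s_add_weight -scaleNr; apply: weightZ; exact: weight_z.
by apply: wt (weight_z i) (weight_z j) _; rewrite brE; exact: weight0.
Qed.

Lemma tau_skew i : csym chi L L (skew i) = - skew i.
Proof.
rewrite /skew !linE !tauE scalerA mulfV ?bichar_neq0 // scale1r.
by rewrite opprB.
Qed.

Lemma act_skew a i :
  (@ten_act C f L L act act : gmor _ (gtens L L)) (a ⊗ skew i) = 0.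
Proof.
by rewrite /skew !linE !ten_actE !(actE, linE, simplE).
Qed.

Lemma weight_skew i :
  @weight _ _ (gtens L L) (@ten_coact C f L L coact coact) (skew i)
    (i.+1%:R *: s + t).
Proof.
rewrite -s_add_weight; apply: weightB.
  apply: weightZ; rewrite addrC.
  exact: (weight_tens chi (weight_z i) weight_x1).
exact: (weight_tens chi weight_x1 (weight_z i)).
Qed.

Lemma cobr_crossed : @crossed_morphism C f L (gtens L L)
  act coact (@ten_act C f L L act act) (@ten_coact C f L L coact coact) cobr.
Proof.
apply: (crossed_morphism_weight chi spans_generator) => [a|] _ [||i].
- by rewrite !(actE, cobrE, simplE).
- by rewrite !(actE, gmorZ, cobrE, simplE).
- by rewrite act_z cobr_z gmor0 tpureZr gmorZ act_skew scaler0.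
- by exists s; rewrite cobr_x1; split; [exact: weight_x1|exact: weight0].
- by exists s; rewrite cobr_x2; split; [exact: weight_x2|exact: weight0].
exists (i%:R *: s + t); split; first exact: weight_z.
rewrite cobr_z; case: i => [|i].
  by rewrite cobr_coef0 scale0r; exact: weight0.
by apply: weightZ; exact: weight_skew.
Qed.

(** * Lie algebra and Lie coalgebra axioms *)

Lemma br_lie_algebra : @lie_algebra C L br.
Proof.
have cVc : c^-1 * c = 1 by rewrite mulVf ?bichar_neq0.
split=> /=.
  apply: (gmor_ext (spans_tens spans_generator spans_generator)).
  move=> _ [u [v [gu gv ->]]].
  case: gu => [||i]; case: gv => [||j]; rewrite !evalE tauE !(linE, brE, simplE) //.
    by rewrite scalerN scalerA mulrC cVc scale1r subrr.
  by rewrite addrC subrr.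
apply: (gmor_ext
  (spans_tens (spans_tens spans_generator spans_generator) spans_generator)).
move=> _ [_ [w [[u [v [gu gv ->]]] gw ->]]].
case: gu => [||i]; case: gv => [||j]; case: gw => [||l];
  rewrite !evalE tauE.
all: rewrite ?tpureZl 3!gmorB ?gmorZ !evalE !brE.
all: rewrite ?(tpureNl, tpureNr, tpureZl, tpureZr, gmorN, gmorZ, brE, simplE) //.
(* The only triple where both terms on the right contribute is x2, x2, z l. *)
by rewrite subrr.
Qed.

(** As [delta x1 = 0], only the [z]-factor of [delta (z i)] is split again, so both
    sides of the co-Jacobi identity are multiples of
    [cobr_coef i * cobr_coef i.-1]. *)
Lemma cobr_lie_coalgebra : @lie_coalgebra C L cobr.
Proof.
split=> /=; apply: (gmor_ext spans_generator) => _ [||i].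
- by rewrite !evalE !(cobrE, simplE).
- by rewrite !evalE !(cobrE, simplE).
- by rewrite !evalE cobr_z gmorZ tau_skew -scalerDr subrr scaler0.
- by rewrite !evalE !(cobrE, simplE).
- by rewrite !evalE !(cobrE, simplE).
rewrite !evalE cobr_z.
move: (cobr_coef i) => d; rewrite /skew !(linE, evalE, tauE, cobrE, simplE).
have reorder (V : lmodType k) d' (p q r : V) :
    d *: (c *: (d' *: (c *: p - q))) =
    d *: - (d' *: (c *: q - r)) - d *: - (d' *: (c *: (c *: p) - r)).
  rewrite !scalerN opprK [RHS]addrC -!scalerBr [c *: (d' *: _)]scalerA.
  rewrite [c * d']mulrC -scalerA; congr (_ *: (_ *: _)).
  by rewrite opprB addrA subrK scalerBr.
exact: reorder.
Qed.

(** * Infinitesimal braiding and compatibility *)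

Definition eta : gmor (gtens L L) (gtens L L) :=
  @eta_hat C f L L act coact act coact.

Lemma eta_weight p q u v a b :
  homog p u -> homog q v -> weight coact u a -> weight coact v b ->
  eta (u ⊗ v) = act (b ⊗ u) ⊗ v + u ⊗ act (a ⊗ v).
Proof. exact: eta_hatE. Qed.

Lemma eta_x1x1 : eta (x1 ⊗ x1) = 0.
Proof.
rewrite (eta_weight x1_homog x1_homog weight_x1 weight_x1).
by rewrite !(actE, simplE).
Qed.

Lemma eta_x1x2 : eta (x1 ⊗ x2) = x1 ⊗ x1.
Proof.
rewrite (eta_weight x1_homog x2_homog weight_x1 weight_x2).
by rewrite !(actE, simplE) psi_s scale1r.
Qed.

Lemma eta_x2x1 : eta (x2 ⊗ x1) = x1 ⊗ x1.
Proof.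
rewrite (eta_weight x2_homog x1_homog weight_x2 weight_x1).
by rewrite !(actE, simplE) psi_s scale1r.
Qed.

Lemma eta_x2x2 : eta (x2 ⊗ x2) = x1 ⊗ x2 + x2 ⊗ x1.
Proof.
rewrite (eta_weight x2_homog x2_homog weight_x2 weight_x2).
by rewrite !(actE, simplE) psi_s scale1r.
Qed.

Lemma eta_x1z i : eta (x1 ⊗ z i) = 0.
Proof.
rewrite (eta_weight x1_homog (z_homog i) weight_x1 (weight_z i)).
by rewrite !(actE, simplE).
Qed.

Lemma eta_zx1 i : eta (z i ⊗ x1) = 0.
Proof.
rewrite (eta_weight (z_homog i) x1_homog (weight_z i) weight_x1).
by rewrite !(actE, simplE).
Qed.

Lemma eta_x2z i : eta (x2 ⊗ z i) = (i%:R - n%:R / 2%:R) *: (x1 ⊗ z i).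
Proof.
rewrite (eta_weight x2_homog (z_homog i) weight_x2 (weight_z i)).
by rewrite !(actE, simplE) psi_z tpureZl.
Qed.

Lemma eta_zx2 i : eta (z i ⊗ x2) = (i%:R - n%:R / 2%:R) *: (z i ⊗ x1).
Proof.
rewrite (eta_weight (z_homog i) x2_homog (weight_z i) weight_x2).
by rewrite !(actE, simplE) psi_z tpureZr.
Qed.

Lemma eta_zz i j : eta (z i ⊗ z j) = 0.
Proof.
rewrite (eta_weight (z_homog i) (z_homog j) (weight_z i) (weight_z j)).
by rewrite !(actE, simplE).
Qed.

Definition etaE := (eta_x1x1, eta_x1x2, eta_x2x1, eta_x2x2,
  eta_x1z, eta_zx1, eta_x2z, eta_zx2, eta_zz).

(** The composite of the compatibility condition that is antisymmetrized on both
    sides: [u ⊗ v |-> (beta ⊗ id) (id ⊗ tau) (delta u ⊗ v)]. *)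
Definition cross : gmor (gtens L L) (gtens L L) :=
  gcomp (gten br (gid L)) (gcomp (gcas L L L) (gcomp (gten (gid L) (csym chi L L))
    (gcomp (gasc L L L) (gten cobr (gid L))))).

Lemma cross0 u : cobr u = 0 -> forall v, cross (u ⊗ v) = 0.
Proof. by move=> du v; rewrite !evalE du tpure0l !gmor0. Qed.

Lemma cross_zx1 i : cross (z i ⊗ x1) = 0.
Proof.
by rewrite /cross !evalE cobr_z /skew !(linE, evalE, tauE, brE, simplE).
Qed.

Lemma cross_zz i j : cross (z i ⊗ z j) = 0.
Proof.
by rewrite /cross !evalE cobr_z /skew !(linE, evalE, tauE, brE, simplE).
Qed.

(** The other summand of [delta (z i)] starts with [x1], whose bracket with [x2]
    vanishes. *)
Lemma cross_zx2 i : cross (z i ⊗ x2) = - (cobr_coef i *: (z i ⊗ x1)).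
Proof.
rewrite /cross !evalE cobr_z /skew !(linE, evalE, tauE, brE, simplE).
rewrite !scalerN [c *: (_ *: _)]scalerA mulfV ?bichar_neq0 // scale1r.
(* At [i = 0] the indices [i.-1.+1] and [i] differ, but the coefficient is 0. *)
by case: i => //; rewrite cobr_coef0 !scale0r.
Qed.

Definition crossE := (cross0 cobr_x1, cross0 cobr_x2,
  cross_zx1, cross_zx2, cross_zz).

(** The cases [x2 ⊗ z j] and [z i ⊗ x2] reduce to [cobr_coefS].  On two
    [x]'s, at least one of them [x2], the infinitesimal braiding does not vanish,
    but its value is symmetric, hence killed by [tau - id]. *)
Lemma lie_compat_generators u v : generator u -> generator v ->
  let y := cross (u ⊗ v - csym chi L L (u ⊗ v)) in
  cobr (br (u ⊗ v)) =
    y - csym chi L L y + (csym chi L L (eta (u ⊗ v)) - eta (u ⊗ v)).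
Proof.
have tau_x1z i : csym chi L L (x1 ⊗ z i) - x1 ⊗ z i = skew i by rewrite tauE.
have tau_zx1 i : z i ⊗ x1 - csym chi L L (z i ⊗ x1) = c^-1 *: skew i.
  by rewrite tauE scalerBr scalerA mulVf ?bichar_neq0 // scale1r.
case=> [||i]; case=> [||j].
- by rewrite gmorB /= !(tauE, brE, crossE, etaE, simplE).
- by rewrite gmorB /= !(tauE, brE, crossE, etaE, subrr, simplE).
- by rewrite gmorB /= !(tauE, gmorZ, brE, crossE, etaE, simplE).
- by rewrite gmorB /= !(tauE, brE, crossE, etaE, subrr, simplE).
- rewrite gmorB /= !(tauE, brE, crossE, etaE, gmorD, simplE).
  by rewrite [x2 ⊗ x1 + _]addrC subrr.
- rewrite br_x2z cobr_z cobr_coefS /=.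
  have -> : cross (x2 ⊗ z j - csym chi L L (x2 ⊗ z j)) =
      (c * cobr_coef j) *: (z j ⊗ x1).
    by rewrite gmorB tauE gmorZ !crossE sub0r scalerN opprK scalerA.
  rewrite eta_x2z !gmorZ -!scalerBr tau_zx1 tau_x1z scalerA -scalerDl.
  by rewrite mulrAC mulfV ?bichar_neq0 // mul1r.
- by rewrite gmorB /= !(tauE, gmorZ, brE, crossE, etaE, simplE).
- rewrite br_zx2 gmorN gmorZ cobr_z cobr_coefS /=.
  have -> : cross (z i ⊗ x2 - csym chi L L (z i ⊗ x2)) =
      (- cobr_coef i) *: (z i ⊗ x1).
    by rewrite gmorB tauE gmorZ !crossE scaler0 subr0 scaleNr.
  rewrite eta_zx2 !gmorZ -!scalerBr -[csym _ _ _ _ - _]opprB tau_zx1.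
  rewrite -!scaleNr !scalerA -scalerDl; congr (_ *: _).
  by ring.
by rewrite gmorB /= !(tauE, gmorZ, brE, crossE, etaE, simplE).
Qed.

Lemma lie_compat_L : @lie_compat C L eta br cobr.
Proof.
apply: (gmor_ext (spans_tens spans_generator spans_generator)).
move=> _ [u [v [gu gv ->]]]; exact: lie_compat_generators gu gv.
Qed.

(** It is detected at [x2 ⊗ x2] by the product of the coordinate of [x1] on the
    left factor and that of [x2] on the right one. *)
Lemma eta_neq0 : eta <> 0.
Proof.
move=> eta0; have := eta_x2x2; rewrite eta0 gzeroE => /esym.
pose b (u v : L) : k^o :=
  (u : {ffun _ -> k^o}) (inl 0) * (v : {ffun _ -> k^o}) (inl 1).
have bb : bilin b.
  split=> [w a u v|u a v w]; rewrite /b /GRing.scale !ffunE /= /GRing.scale /=.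
    by rewrite mulrDl mulrA.
  by rewrite mulrDr mulrCA.
move/(congr1 (tlift b)); rewrite -[x1 ⊗ x2]scale1r tlift_linear // scale1r.
rewrite !tlift_pure // (linear0f (tlift_linear bb)) /b !ffunE /=.
by rewrite mulr1 mulr0 addr0 => /eqP; rewrite oner_eq0.
Qed.

(** * The Lie bialgebra [L(1, n)] *)

Lemma L0_ker (U : lmodType k) (p : L -> U) : linear p ->
  p x1 = 0 -> (forall i, p (z i) = 0) -> forall x : L, x \in L0 k g h n -> p x = 0.
Proof.
move=> lp p1 pz x; rewrite /L0 => /coord_span ->.
pose P := HB.pack_for {linear L -> U} p (GRing.isLinear.Build _ _ _ _ _ lp).
have pZ a (v : L) : p (a *: v) = a *: p v.
  by have /= := lp a v 0; rewrite (linear0f lp) !addr0.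
rewrite -[LHS]/(P _) raddf_sum big1 // => i _; apply: etrans (pZ _ _) _.
set v := nth _ _ _; suff -> : p v = 0 by rewrite scaler0.
have : v \in x1 :: [seq zvec k g h n (Posz j) | j <- iota 0 n.+1].
  by apply: mem_nth; rewrite /= size_map size_iota.
by rewrite inE => /orP[/eqP ->|/mapP[j _ ->]]; [exact: p1|exact: pz].
Qed.

End Construction.

Theorem proposition7p4 (k : fieldType) (hk : 2%N \notin [pchar k])
    (G : zmodType) (g h : G)
    (hgen : forall a : G, exists i j : int, a = g *~ i + h *~ j)
    (hiso : exists phi : {additive (int * int)%type -> G}, bijective phi)
    (chi : antisymBichar k G) (hg : chi g g = 1) (hh : chi h h = 1)
    (n : nat) :
  let C : cartierCat := zeroCartier (colorCat chi) in
  let f : lieBialgebra C := Fbialg chi in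
  let F : gspace k G := Fspace k G in
  let s : F := svec k G in
  let t : F := tvec k G in
  let L : gspace k G := Lspace k g h n in
  let x1 : L := x1 k g h n in
  let x2 : L := x2 k g h n in
  let z : int -> L := @zvec k G g h n in
  let tau := csym chi L L in
  exists (alpha : gmor (gtens F L) L) (lambda : gmor L (gtens F L)),
    [/\ lambda x1 = s ⊗ x1,
        lambda x2 = s ⊗ x2
      & forall i : nat, (i <= n)%N -> lambda (z i) = (i%:R *: s + t) ⊗ z i] /\
    [/\ alpha (s ⊗ x2) = x1,
        alpha (t ⊗ x2) = - (n%:R / 2%:R) *: x1
      & forall x : L, x \in L0 k g h n ->
          alpha (s ⊗ x) = 0 /\ alpha (t ⊗ x) = 0] /\
    @crossed_module C f L alpha lambda /\
    @eta_hat C f L L alpha lambda alpha lambda <> 0 /\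
    exists (beta : gmor (gtens L L) L) (delta : gmor L (gtens L L)),
      [/\ forall x y : L, x \in L0 k g h n -> y \in L0 k g h n ->
            beta (x ⊗ y) = 0,
          [/\ beta (x2 ⊗ x1) = 0, beta (x2 ⊗ x2) = 0 & beta (x1 ⊗ x2) = 0]
        & forall i : nat, (i <= n)%N ->
            beta (x2 ⊗ z i) = z (i%:Z + 1) /\
            - beta (tau (x2 ⊗ z i)) = z (i%:Z + 1)] /\
      [/\ delta x1 = 0,
          delta x2 = 0
        & forall i : nat, (i <= n)%N ->
            delta (z i) = (i%:R * (i%:R - 1 - n%:R) / 2%:R) *:
              (tau (x1 ⊗ z (i%:Z - 1)) - x1 ⊗ z (i%:Z - 1))] /\
      @crossed_lie_bialgebra C f L alpha lambda beta delta.
Proof.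
move=> C f F s t L x1 x2 z' tau.
have two_neq0 : 2%:R != 0 :> k by move: hk; rewrite inE /=.
have linR (U : gspace k G) (V W : gspace k G) (p : gmor (gtens V W) U) (v : V) :
    linear (fun w => p (v ⊗ w)).
  by move=> c u w; rewrite tpureDr tpureZr gmorD gmorZ.
have linL (U : gspace k G) (V W : gspace k G) (p : gmor (gtens V W) U) (w : W) :
    linear (fun v => p (v ⊗ w)).
  by move=> c u v; rewrite tpureDl tpureZl gmorD gmorZ.
have zS (i : nat) : z' (i%:Z + 1) = znat k g h n i.+1.
  by rewrite /z' -PoszD addn1.
exists (act k g h n), (coact k g h n); split.
  by split=> [||i _]; [exact: weight_x1|exact: weight_x2|exact: weight_z].
split.
  split.
  - by rewrite act_x2 psi_s scale1r.
  - by rewrite act_x2 psi_t.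
  by move=> x Lx; split; apply: (L0_ker (linR _ _ _ (act k g h n) _)) Lx => *;
    rewrite ?act_x1 ?act_z.
split; first exact: crossed_module_L.
split; first exact: eta_neq0.
exists (br g h chi n), (cobr g h chi n); split; [|split].
- split.
  + move=> x y Lx Ly; apply: (L0_ker (linL _ _ _ (br g h chi n) y)) Lx => [|i];
      by apply: (L0_ker (linR _ _ _ (br g h chi n) _)) Ly => *; rewrite brE.
  + by rewrite !brE.
  move=> i _; rewrite br_x2z zS; split=> //.
  rewrite /tau tau_xz //; last exact: x2_homog.
  by rewrite gmorZ br_zx2 scalerN opprK scalerA mulfV ?bichar_neq0 // scale1r.
- split=> [||i _]; [exact: cobr_x1|exact: cobr_x2|].
  rewrite [LHS]cobr_z /cobr_coef; case: i => [|i]; first by rewrite !mul0r !scale0r.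
  rewrite (_ : i.+1%:Z - 1 = i%:Z); last by rewrite -addn1 PoszD addrK.
  by rewrite tau_xz //; exact: x1_homog.
split; [split|split].
- exact: crossed_module_L.
- exact: br_crossed.
- exact: cobr_crossed.
- exact: br_lie_algebra.
- exact: cobr_lie_coalgebra.
exact: lie_compat_L.
Qed.
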